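(* Consider on $(\mathcal{S}^2)^4$ the closed-loop system $$\dot{\Gamma}_i=\widehat{\Gamma}_i \sum_{j\in \mathcal{N}_i} f(\theta_{ij})\,\widehat{\Gamma}_i\Gamma_j, \qquad i\in \mathcal{V}=\{1,2,3,4\},$$ where the inter-agent graph is complete, i.e. $\mathcal{N}_i=\mathcal{V}\setminus\{i\}$ for every $i$, and where $f:\mathbb{R}\to\mathbb{R}$ is bounded and satisfies $f>0$ and $\dot f<0$ on $(0,\pi)$. Let $$\Omega_T=\left\{ \mathbf{\Gamma} \in (\mathcal{S}^2)^4 : \Gamma^T_i\Gamma_j = -\tfrac{1}{3}\ \ \forall\, i \neq j \right\}.$$ Then the following hold. (1) The manifold $\Omega_T$ is the center manifold of the closed-loop system at any formation $\mathbf{\Gamma}^*\in \Omega_T$. (2) The set of regular tetrahedron formations $\Omega_T$ is locally exponentially stable for the closed-loop system.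
   Context: $\mathcal{S}^2=\{x\in\mathbb{R}^3:\|x\|=1\}$. A point $\mathbf{\Gamma}=(\Gamma_1,\Gamma_2,\Gamma_3,\Gamma_4)\in(\mathcal{S}^2)^4$ collects the reduced attitudes of four agents. For $x=[x_1,x_2,x_3]^T\in\mathbb{R}^3$, $$\widehat{x}=\begin{pmatrix}0&-x_3&x_2\\ x_3&0&-x_1\\ -x_2&x_1&0\end{pmatrix},$$ so $\widehat{x}y=x\times y$. $\theta_{ij}=\arccos(\Gamma_i^T\Gamma_j)\in[0,\pi]$. $\mathcal{N}_i$ denotes the neighbor set of agent $i$ in the inter-agent graph. The system is $\dot\Gamma_i=\widehat{\omega}_i\Gamma_i$ under the control $\omega_i=-\sum_{j\in\mathcal{N}_i}f(\theta_{ij})\widehat{\Gamma}_i\Gamma_j$. $\dot f$ denotes the derivative of $f$. *)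

(* Defs.v *)
From HB Require Import structures.
From mathcomp Require Import all_boot all_order all_algebra.
From mathcomp Require Import all_classical all_reals all_analysis.
From mathcomp Require Import complex.

Set Implicit Arguments.
Unset Strict Implicit.
Unset Printing Implicit Defensive.

Import Order.TTheory GRing.Theory Num.Theory.
Import numFieldNormedType.Exports.

Local Open Scope classical_set_scope.
Local Open Scope ring_scope.

(** * Submanifolds of a normed space *)

(* [Ck k U g]: [g] is of class C^k on the open set [U].  The recursion on
   directional derivatives gives the usual notion when [V] is
   finite-dimensional, the only case used below. *)
Fixpoint Ck (R : realType) (V : normedModType R) (k : nat) (U : set V)
    (g : V -> R) : Prop :=
  if k is k'.+1 then
    (forall x, U x -> differentiable g x) /\
    (forall v : V, Ck k' U (fun x => 'D_v g x))
  else forall x, U x -> {for x, continuous g}.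

Definition smooth_on (R : realType) (V : normedModType R) (U : set V)
    (g : V -> R) : Prop :=
  forall k, Ck k U g.

(* Smooth embedded submanifold of codimension [c]: locally the zero set of
   [c] smooth scalar functions whose joint differential is onto R^c. *)
Definition submanifold (R : realType) (V : normedModType R) (c : nat)
    (M : set V) : Prop :=
  forall p, M p -> exists (U : set V) (phi : 'I_c -> V -> R),
    [/\ open U, U p,
        forall i, smooth_on U (phi i),
        forall x, U x -> forall y : 'I_c -> R,
          exists h : V, forall i, 'd (phi i) x h = y i &
        forall x, U x -> (M x <-> forall i, phi i x = 0)].

(* Velocities at [p] of the curves lying in [M]. *)
Definition tangent_space (R : realType) (V : normedModType R) (M : set V)
    (p : V) : set V :=
  [set v | exists gamma : R -> V,
     [/\ gamma 0 = p, (\forall t \near (0 : R), M (gamma t)) &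
         is_derive (0 : R) 1 gamma v]].

(** * Autonomous systems [x' = F x] on a subset [X] of a normed space *)

(* At an endpoint belonging to [I], only one-sided continuity is required. *)
Definition solution (R : realType) (V : normedModType R) (X : set V)
    (F : V -> V) (I : set R) (gamma : R -> V) : Prop :=
  [/\ forall t, I t -> X (gamma t),
      {within I, continuous gamma} &
      forall t, I° t -> is_derive t 1 gamma (F (gamma t))].

Definition invariant_set (R : realType) (V : normedModType R) (X : set V)
    (F : V -> V) (W : set V) : Prop :=
  forall (I : set R) (gamma : R -> V), is_interval I ->
    solution X F I gamma ->
    forall t0, I t0 -> W (gamma t0) -> forall t, I t -> W (gamma t).

Definition dist_set (R : realType) (V : normedModType R) (A : set V)
    (x : V) : R :=
  inf [set `|x - y| | y in A].

(* The norm of 'M[R]_(m, n) is the max norm; replacing it by an equivalent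
   norm only changes [delta] and [k]. *)
Definition locally_exponentially_stable (R : realType) (V : normedModType R)
    (X : set V) (F : V -> V) (A : set V) : Prop :=
  exists delta k lambda : R,
    [/\ 0 < delta, 0 < k, 0 < lambda &
      forall (I : set R) (gamma : R -> V), is_interval I -> I 0 ->
        solution X F I gamma ->
        dist_set A (gamma 0) < delta ->
        forall t, I t -> 0 <= t ->
          dist_set A (gamma t) <=
            k * expR (- (lambda * t)) * dist_set A (gamma 0)].

(** * Center manifolds *)

(* Center subspace of the linearization of [F] at the equilibrium [p], as an
   endomorphism of the tangent space [T] of [X] at [p]: the real vectors in the
   complex span of its generalized eigenvectors (in the complexification of
   [T]) for the eigenvalues with zero real part.  The matrix
   [lin_mx ('d F p)] acts on the right of row vectors [mxvec h]. *)
Definition center_subspace (R : realType) (m n : nat)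
    (X : set 'M[R]_(m, n)) (F : 'M[R]_(m, n) -> 'M[R]_(m, n))
    (p : 'M[R]_(m, n)) : set 'M[R]_(m, n) :=
  [set v | exists (l : nat) (mu : 'I_l -> R[i])
                  (w : 'I_l -> 'rV[R[i]]_(m * n)),
     (forall k,
        [/\ complex.Re (mu k) = 0,
            (w k <= geigenspace
                      (map_mx (real_complex R) (lin_mx ('d F p))) (mu k))%MS,
            tangent_space X p (vec_mx (map_mx (@complex.Re R) (w k))) &
            tangent_space X p (vec_mx (map_mx (@complex.Im R) (w k)))]) /\
     map_mx (real_complex R) (mxvec v) = \sum_(k < l) w k].

Definition center_manifold (R : realType) (m n : nat)
    (X : set 'M[R]_(m, n)) (F : 'M[R]_(m, n) -> 'M[R]_(m, n))
    (W : set 'M[R]_(m, n)) (p : 'M[R]_(m, n)) : Prop :=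
  [/\ F p = 0 /\ differentiable F p,
      W `<=` X /\ W p,
      exists c, submanifold c W,
      invariant_set X F W &
      tangent_space W p = center_subspace X F p].

(** * Reduced attitudes of four agents *)

Definition hat (R : realType) (x : 'cV[R]_3) : 'M[R]_3 :=
  let x1 := x 0 0 in let x2 := x 1 0 in let x3 := x 2%:R 0 in
  \matrix_(i < 3, j < 3)
    nth 0 (nth [::] [:: [::   0; - x3;   x2];
                        [::  x3;    0; - x1];
                        [:: - x2;  x1;    0]] i) j.

Definition dotmul (R : realType) (x y : 'cV[R]_3) : R := (x^T *m y) 0 0.

Definition sphere2 (R : realType) : set 'cV[R]_3 :=
  [set x | Num.sqrt (dotmul x x) = 1].

(* The reduced attitude of agent [i] is column [i]. *)
Definition formations (R : realType) : set 'M[R]_(3, 4) :=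
  [set G | forall i, sphere2 (col i G)].

Definition theta (R : realType) (G : 'M[R]_(3, 4)) (i j : 'I_4) : R :=
  acos (dotmul (col i G) (col j G)).

Definition complete_graph (i : 'I_4) : {set 'I_4} := [set~ i]%SET.

Definition closed_loop (R : realType) (N : 'I_4 -> {set 'I_4}) (f : R -> R)
    (G : 'M[R]_(3, 4)) : 'M[R]_(3, 4) :=
  \matrix_(k < 3, i < 4)
    (hat (col i G) *m
       \sum_(j in N i) f (theta G i j) *: (hat (col i G) *m col j G)) k 0.

Definition Omega_T (R : realType) : set 'M[R]_(3, 4) :=
  [set G | formations G /\
           forall i j, i != j -> dotmul (col i G) (col j G) = - (1 / 3%:R)].

Arguments formations {R}.
Arguments Omega_T {R}.

(* Main.v *)
Require Import Defs.
From mathcomp Require Import all_boot all_order all_algebra.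
From mathcomp Require Import all_classical all_reals all_analysis.
From mathcomp Require Import complex ring lra.
Import Order.TTheory GRing.Theory Num.Theory.
Import numFieldNormedType.Exports.
Local Open Scope classical_set_scope.
Local Open Scope ring_scope.

(** Write [c] for the Gram matrix of a formation and [phi = f \o acos].  On the
    spheres the triple product turns the closed loop into
    [g_i' = - \sum_(j != i) phi (c_ij) (g_j - c_ij g_i)], so the Gram matrix
    evolves autonomously, and [Omega_T] is the fibre over one Gram matrix [T],
    an equilibrium of this reduced flow.  Everything is read off the
    linearization at [T].  Put [a = phi (-1/3) > 0] and [b = phi' (-1/3)],
    which is positive because [f] and [acos] both decrease.  If [sigma] is the
    first variation of the Gram matrix under a velocity tangent to the spheres
    and [r_i] its row sums, then
    [sigma_ij' = - (8/3) b sigma_ij - (4/3) (a - b/3) (r_i + r_j)] and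
    [r_i' = - (8/3) (a + 2b/3) r_i]
    ([polar_gram_diff], [polar_gram_diff_row_sum]): the system is triangular
    with negative real rates.

    Center manifold.  The tangent space of [Omega_T] at [p] is the set of
    velocities with [sigma = 0] ([tangent_Omega_T]): such a velocity is [S p]
    with [S] skew, hence comes from a curve of rotations.  The differential of
    the field vanishes there, since the field vanishes on [Omega_T].
    Conversely, on a generalized eigenvector for a purely imaginary eigenvalue
    the triangular system forces first [r = 0], then [sigma = 0]
    ([generalized_center_tangent]).  [Omega_T] is a submanifold because nine
    polynomial equations with surjective differential cut it out
    ([tetra_eqsP], [diff_tetra_eqs_surj]).

    Stability.  Let [V] be the sum of the squares of the entries of [c - T].
    The linearization above is symmetric and negative definite for the
    corresponding inner product ([gram_field_lin_dissipative]), so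
    [- C V <= V' <= - m V] near [Omega_T] ([energy_rate_bounds]).  As [T] is the
    same at every point of [Omega_T], the expansion of [phi] at [-1/3] serves
    for all of them at once.  Gronwall's inequality gives
    [V (t) <= exp (- m t) V (0)], and, read in both directions of time from a
    zero of [V], the invariance of [Omega_T].  Finally [sqrt V] is comparable
    with the distance to [Omega_T]: it is a Lipschitz function vanishing there
    ([sqrt_energy_le_dist]), and conversely an orthogonal change of frame makes
    the formation triangular, where its entries are determined by [c] and lie
    within [O (sqrt V)] of those of a regular tetrahedron
    ([close_tetrahedron]). *)

(** * Coordinates in dimensions three and four *)

Lemma ord3E (i : 'I_3) : [\/ i = 0, i = 1 | i = 2%:R].
Proof.
case: i => [[|[|[|//]]] Hi].
- by apply: Or31; apply: val_inj.
- by apply: Or32; apply: val_inj.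
- by apply: Or33; apply: val_inj.
Qed.

Lemma forall3 (P : 'I_3 -> Prop) : P 0 -> P 1 -> P 2%:R -> forall i, P i.
Proof. by move=> P0 P1 P2 i; case: (ord3E i) => ->. Qed.

Lemma forall4 (P : 'I_4 -> Prop) :
  P 0 -> P 1 -> P 2%:R -> P 3%:R -> forall i, P i.
Proof.
move=> P0 P1 P2 P3 [[|[|[|[|//]]]] Hi].
- by rewrite (_ : Ordinal _ = 0)//; apply: val_inj.
- by rewrite (_ : Ordinal _ = 1)//; apply: val_inj.
- by rewrite (_ : Ordinal _ = 2%:R)//; apply: val_inj.
- by rewrite (_ : Ordinal _ = 3%:R)//; apply: val_inj.
Qed.

Lemma sum3E (V : nmodType) (F : 'I_3 -> V) : \sum_i F i = F 0 + F 1 + F 2%:R.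
Proof.
rewrite !big_ord_recr big_ord0 /= add0r.
by congr (F _ + F _ + F _); apply: val_inj.
Qed.

Lemma sum4E (V : nmodType) (F : 'I_4 -> V) :
  \sum_i F i = F 0 + F 1 + F 2%:R + F 3%:R.
Proof.
rewrite !big_ord_recr big_ord0 /= add0r.
by congr (F _ + F _ + F _ + F _); apply: val_inj.
Qed.

Lemma sum4_condE (V : nmodType) (P : pred 'I_4) (F : 'I_4 -> V) :
  \sum_(i | P i) F i = (if P 0 then F 0 else 0) + (if P 1 then F 1 else 0)
    + (if P 2%:R then F 2%:R else 0) + (if P 3%:R then F 3%:R else 0).
Proof. by rewrite big_mkcond sum4E. Qed.

Lemma hat_mulE (R : realType) (x y : 'cV[R]_3) :
  hat x *m y = \matrix_(i < 3, j < 1) nth 0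
    [:: x 1 0 * y 2%:R 0 - x 2%:R 0 * y 1 0;
        x 2%:R 0 * y 0 0 - x 0 0 * y 2%:R 0;
        x 0 0 * y 1 0 - x 1 0 * y 0 0] i.
Proof.
apply/matrixP => i j; rewrite ord1 !mxE sum3E !mxE.
by move: i; apply: forall3 => /=; ring.
Qed.

Lemma dotmulE (R : realType) (x y : 'cV[R]_3) :
  dotmul x y = x 0 0 * y 0 0 + x 1 0 * y 1 0 + x 2%:R 0 * y 2%:R 0.
Proof. by rewrite /dotmul mxE sum3E !mxE. Qed.

Lemma hat_hat (R : realType) (x y : 'cV[R]_3) :
  hat x *m (hat x *m y) = dotmul x y *: x - dotmul x x *: y.
Proof.
rewrite !hat_mulE; apply/matrixP => i j; rewrite ord1 !mxE /= !dotmulE.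
by move: i; apply: forall3 => /=; ring.
Qed.

(** * The field in terms of Gram matrices, and regular tetrahedra *)

Lemma dotmul_col (R : realType) (G H : 'M[R]_(3, 4)) i j :
  dotmul (col i G) (col j H) = (G^T *m H) i j.
Proof. by rewrite dotmulE [RHS]mxE sum3E !mxE. Qed.

Lemma closed_loopE (R : realType) (f : R -> R) (G : 'M[R]_(3, 4)) k i :
  closed_loop complete_graph f G k i =
  \sum_(j | j != i) f (acos ((G^T *m G) i j)) *
    ((G^T *m G) i j * G k i - (G^T *m G) i i * G k j).
Proof.
rewrite mxE mulmx_sumr summxE; apply: eq_big => [j|j _].
  by rewrite !inE.
by rewrite -scalemxAr hat_hat /theta !dotmul_col !mxE.
Qed.

(** Against any second family of vectors, the field only sees the
    pairings of that family with the agents; with [H = G] this closes the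
    dynamics of the Gram matrix. *)
Lemma closed_loop_dot (R : realType) (f : R -> R) (G H : 'M[R]_(3, 4)) i j :
  ((closed_loop complete_graph f G)^T *m H) i j =
  \sum_(k | k != i) f (acos ((G^T *m G) i k)) *
    ((G^T *m G) i k * (G^T *m H) i j - (G^T *m G) i i * (G^T *m H) k j).
Proof.
rewrite mxE; under eq_bigr => l _ do rewrite mxE closed_loopE mulr_suml.
rewrite exchange_big /=; apply: eq_bigr => k _.
rewrite [(G^T *m H) i j]mxE [(G^T *m H) k j]mxE.
under eq_bigr => l _ do rewrite -mulrA mulrBl.
rewrite -mulr_sumr sumrB !mulr_sumr.
by congr (_ * (_ - _)); apply: eq_bigr => l _; rewrite -mulrA !mxE.
Qed.

Definition tetra_gram (R : realType) : 'M[R]_4 :=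
  (4 / 3)%:M - const_mx (1 / 3).

Lemma tetra_gramE (R : realType) i j :
  tetra_gram R i j = if i == j then 1 else - (1 / 3).
Proof. by rewrite !mxE; case: eqP => _ /=; field. Qed.

Lemma formationsP (R : realType) (G : 'M[R]_(3, 4)) :
  formations G <-> forall i, (G^T *m G) i i = 1.
Proof.
rewrite /formations /=; split=> h i.
  have := h i; rewrite /sphere2 /= dotmul_col => h1.
  have : Num.sqrt ((G^T *m G) i i) ^+ 2 = 1 by rewrite h1 expr1n.
  rewrite sqr_sqrtr // mxE; apply: sumr_ge0 => k _.
  by rewrite !mxE -expr2 sqr_ge0.
by rewrite /sphere2 /= dotmul_col h sqrtr1.
Qed.

Lemma Omega_TP (R : realType) (G : 'M[R]_(3, 4)) :
  Omega_T G <-> G^T *m G = tetra_gram R.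
Proof.
split=> [[/formationsP G1 Gij]|GG].
  apply/matrixP => i j; rewrite tetra_gramE; case: eqP => [->|/eqP ij].
    exact: G1.
  by rewrite -dotmul_col Gij.
split; first by apply/formationsP => i; rewrite GG tetra_gramE eqxx.
by move=> i j ij; rewrite dotmul_col GG tetra_gramE (negbTE ij).
Qed.

Lemma trmx_mul_eq0 (R : realType) m n (A : 'M[R]_(m, n)) :
  \tr (A^T *m A) = 0 -> A = 0.
Proof.
rewrite /mxtrace; under eq_bigr => i _ do rewrite mxE.
move=> h; apply/matrixP => i j; rewrite [RHS]mxE.
move/eqP: h; rewrite psumr_eq0 => [/allP/(_ j)|k _]; last first.
  by apply: sumr_ge0 => l _; rewrite mxE -expr2 sqr_ge0.
rewrite mem_index_enum => /(_ isT) /=; rewrite psumr_eq0; last first.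
  by move=> l _; rewrite mxE -expr2 sqr_ge0.
move=> /allP/(_ i); rewrite mem_index_enum => /(_ isT) /=.
by rewrite mxE -expr2 sqrf_eq0 => /eqP.
Qed.

(** The sum of the vertices has squared norm [1^T T 1 = 0]. *)
Lemma tetra_sum0 (R : realType) (p : 'M[R]_(3, 4)) :
  p^T *m p = tetra_gram R -> p *m const_mx 1 = 0 :> 'cV_3.
Proof.
move=> pp; apply: trmx_mul_eq0; rewrite trmx_mul mulmxA -(mulmxA _ p^T) pp.
rewrite /mxtrace big_ord1 mxE sum4E !mxE !sum4E !mxE /=.
by field.
Qed.

(** The vertices form a tight frame.  With [N = p p^T], the relation
    [p 1 = 0] gives [N^2 = (4/3) N]; so [4/3 - N] is symmetric, is [4/3] times a
    projection, and has trace [4 - 4 = 0]. *)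
Lemma tetra_frame (R : realType) (p : 'M[R]_(3, 4)) :
  p^T *m p = tetra_gram R -> p *m p^T = (4 / 3)%:M.
Proof.
move=> pp; have p0 := tetra_sum0 _ _ pp.
pose N := p *m p^T.
have Ntr : N^T = N by rewrite trmx_mul trmxK.
have NN : N *m N = (4 / 3) *: N.
  rewrite /N mulmxA -(mulmxA p) pp mulmxBr mulmxBl mul_mx_scalar -scalemxAl.
  have -> : const_mx (1 / 3) = const_mx 1 *m ((1 / 3) *: const_mx 1 : 'rV_4)
      :> 'M[R]_4.
    by apply/matrixP => i j; rewrite !mxE big_ord1 !mxE mulr1 [RHS]mul1r.
  by rewrite (mulmxA p) p0 !mul0mx subr0.
have trN : \tr N = 4.
  by rewrite mxtrace_mulC pp /mxtrace !sum4E !mxE /=; field.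
suff : (4 / 3)%:M - N = 0 by move/eqP; rewrite subr_eq0 => /eqP/esym.
apply: trmx_mul_eq0; have -> : ((4 / 3)%:M - N)^T = (4 / 3)%:M - N.
  by rewrite [LHS]linearB /= tr_scalar_mx Ntr.
rewrite mulmxBl !mulmxBr mul_scalar_mx mul_mx_scalar mul_scalar_mx NN subrr subr0.
rewrite linearB /= !mxtraceZ mxtrace_scalar trN.
by field.
Qed.

(** * Differentiating the Gram matrix and the field *)

Lemma differentiable_bigsum (R : realType) (V W : normedModType R) (I : Type)
    (r : seq I) (P : pred I) (h : I -> V -> W) x :
  (forall i, P i -> differentiable (h i) x) ->
  differentiable (fun y => \sum_(i <- r | P i) h i y) x.
Proof.
move=> dh; elim: r => [|i r IH].
  by under eq_fun do rewrite big_nil; exact: differentiable_cst.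
case Pi : (P i); under eq_fun do rewrite big_cons Pi; last exact: IH.
exact: (differentiableD (dh _ Pi) IH).
Qed.

Lemma is_derive_bigsum (R : realType) (V W : normedModType R) (I : Type)
    (r : seq I) (P : pred I) (h : I -> V -> W) (dh : I -> W) x v :
  (forall i, P i -> is_derive x v (h i) (dh i)) ->
  is_derive x v (fun y => \sum_(i <- r | P i) h i y) (\sum_(i <- r | P i) dh i).
Proof.
move=> dhP; elim: r => [|i r IH].
  rewrite big_nil; under eq_fun do rewrite big_nil.
  exact: is_derive_cst.
rewrite big_cons; case Pi : (P i); under eq_fun do rewrite big_cons Pi;
  last exact: IH.
exact: (is_deriveD (dhP _ Pi) IH).
Qed.

Lemma differentiable_mx (R : realType) (V : normedModType R) m n
    (M : V -> 'M[R]_(m, n)) x :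
  (forall i j, differentiable (fun y => M y i j) x) -> differentiable M x.
Proof.
move=> dM; have -> : M = fun y => \sum_i \sum_j M y i j *: delta_mx i j.
  by apply/funext => y; exact: matrix_sum_delta.
apply: differentiable_bigsum => i _; apply: differentiable_bigsum => j _.
exact: differentiableZl.
Qed.

Lemma is_derive_coord (R : realType) m n (x v : 'M[R]_(m, n)) i j :
  is_derive x v (fun M : 'M[R]_(m, n) => M i j : R) (v i j).
Proof.
have did : derivable (@id 'M[R]_(m, n)) x v by exact: derivable_id.
have := derive_mx did; rewrite derive_id => /matrixP/(_ i j).
rewrite mxE => vE; apply: DeriveDef; last by rewrite vE.
exact: ((derivable_mxP _ _ _).1 did i j).
Qed.

(** The differential of [G |-> G^T G] at [p] in the direction [v]. *)
Definition polar_gram {R : realType} {n m} (p v : 'M[R]_(m, n)) : 'M[R]_n :=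
  v^T *m p + p^T *m v.

Lemma differentiable_gram (R : realType) m n (x : 'M[R]_(m, n)) i j :
  differentiable (fun G : 'M[R]_(m, n) => (G^T *m G) i j : R) x.
Proof.
under eq_fun do rewrite mxE.
apply: differentiable_bigsum => k _.
under eq_fun do rewrite mxE.
by apply: differentiableM; apply: differentiable_coord.
Qed.

Lemma is_derive_gram (R : realType) m n (x v : 'M[R]_(m, n)) i j :
  is_derive x v (fun G : 'M[R]_(m, n) => (G^T *m G) i j : R)
    (polar_gram x v i j).
Proof.
under eq_fun do rewrite mxE.
have -> : polar_gram x v i j = \sum_k (x k i * v k j + x k j * v k i).
  rewrite !mxE -big_split /=; apply: eq_bigr => k _.
  by rewrite !mxE addrC [v k i * _]mulrC.
apply: is_derive_bigsum => k _.
under eq_fun do rewrite mxE.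
exact: (is_deriveM (is_derive_coord _ _ _ _ _ _ _) (is_derive_coord _ _ _ _ _ _ _)).
Qed.

Lemma diff_gram (R : realType) m n (x v : 'M[R]_(m, n)) i j :
  'd (fun G : 'M[R]_(m, n) => (G^T *m G) i j : R) x v =
  polar_gram x v i j.
Proof.
rewrite -deriveE; last exact: differentiable_gram.
exact/derive_val/is_derive_gram.
Qed.

Lemma acos_third_itv (R : realType) : 0 < acos (- (1 / 3) : R) < pi.
Proof. by rewrite acos_gt0 ?acos_ltpi //; apply/andP; split; lra. Qed.

(** [f] and [acos] both decrease, so the coupling strength increases
    with the inner product; [b] is its slope at the tetrahedral value. *)
Lemma coupling_derive (R : realType) (f : R -> R)
    (f_derivable : forall x : R, 0 < x < pi -> derivable f x 1)
    (df_lt0 : forall x : R, 0 < x < pi -> (f^`())%classic x < 0) :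
  exists2 b, 0 < b & is_derive (- (1 / 3) : R) 1 (f \o acos) b.
Proof.
have th := acos_third_itv R.
have h : -1 < (- (1 / 3) : R) < 1 by apply/andP; split; lra.
have dacos := is_derive1_acos h.
have df : is_derive (acos (- (1 / 3) : R)) 1 f (f^`()%classic (acos (- (1 / 3)))).
  by rewrite derive1E; apply: derivableP; exact: f_derivable.
exists (f^`()%classic (acos (- (1 / 3))) *
        - (Num.sqrt (1 - (- (1 / 3)) ^+ 2))^-1).
  rewrite mulrN -mulNr mulr_gt0 ?oppr_gt0 ?df_lt0 // invr_gt0 sqrtr_gt0.
  lra.
exact: is_derive1_comp.
Qed.

Section Linearization.
Context (R : realType) (f : R -> R) (b : R).
Hypothesis db : is_derive (- (1 / 3) : R) 1 (f \o acos) b.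
Variable p : 'M[R]_(3, 4).
Hypothesis pp : p^T *m p = tetra_gram R.
Local Notation F := (closed_loop complete_graph f).
Local Notation a := (f (acos (- (1 / 3)))).

Let pp_off i j : j != i -> (p^T *m p) i j = - (1 / 3).
Proof. by rewrite pp tetra_gramE eq_sym => /negbTE ->. Qed.

Let pp_diag i : (p^T *m p) i i = 1.
Proof. by rewrite pp tetra_gramE eqxx. Qed.

Lemma differentiable_closed_loop : differentiable F p.
Proof.
apply: differentiable_mx => k i.
under eq_fun do rewrite closed_loopE.
apply: differentiable_bigsum => j ji.
apply: (@differentiableM _ _ ((f \o acos) \o fun G : 'M[R]_(3, 4) => (G^T *m G) i j)
  (fun G : 'M[R]_(3, 4) => (G^T *m G) i j * G k i - (G^T *m G) i i * G k j)).
  apply: differentiable_comp; first exact: differentiable_gram.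
  by rewrite pp_off//; apply/derivable1_diffP; exact: ex_derive.
by apply: differentiableB; apply: differentiableM;
  (exact: differentiable_gram || exact: differentiable_coord).
Qed.

Lemma closed_loop_tetra : F p = 0.
Proof.
apply/matrixP => k i; rewrite closed_loopE [RHS]mxE.
under eq_bigr => j ji do rewrite pp_off// pp_diag [1 * p _ _]mul1r.
rewrite -mulr_sumr.
have /matrixP/(_ k 0) := tetra_sum0 _ _ pp; rewrite mxE [RHS]mxE.
under eq_bigr => j _ do rewrite mxE mulr1.
rewrite (bigD1 i) //= addrC => /eqP; rewrite addr_eq0 => /eqP ps.
rewrite sumrB ps sumr_const cardC1 card_ord /= opprK.
by apply/eqP; rewrite mulf_eq0; apply/orP; right; apply/eqP; field.
Qed.

(** The hypothesis says that agent [i] moves tangentially to its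
    sphere: the variation of [c_ii] then drops out. *)
Lemma diff_closed_loopE v k i : polar_gram p v i i = 0 ->
  'd F p v k i = \sum_(j | j != i)
    (b * polar_gram p v i j * (- (1 / 3) * p k i - p k j)
     + a * (polar_gram p v i j * p k i - 1 / 3 * v k i - v k j)).
Proof.
move=> vi; have dF := differentiable_closed_loop.
rewrite -deriveE// derive_mx; last exact: diff_derivable.
rewrite mxE; apply: derive_val.
under eq_fun do rewrite closed_loopE.
apply: is_derive_bigsum => j ji.
have dg := is_derive_gram R _ _ p v.
have dc := is_derive_coord R _ _ p v.
have dphi : is_derive p v (fun G : 'M[R]_(3, 4) => f (acos ((G^T *m G) i j)))
    (b * polar_gram p v i j).
  have df1 : differentiable (f \o acos) ((p^T *m p) i j).
    by rewrite pp_off//; apply/derivable1_diffP; exact: ex_derive.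
  have dd : differentiable ((f \o acos) \o fun G : 'M[R]_(3, 4) => (G^T *m G) i j) p.
    by apply: differentiable_comp => //; exact: differentiable_gram.
  apply: DeriveDef; first exact: (@diff_derivable _ _ _ _ _ v dd).
  rewrite (@deriveE _ _ _ _ _ v dd) diff_comp//=; last exact: differentiable_gram.
  rewrite diff_gram.
  have d1 : (f \o acos)^`()%classic (- (1 / 3)) = b.
    by rewrite derive1E; exact: derive_val.
  by rewrite diff1E// pp_off// d1 mulrC.
have h := is_deriveM dphi (is_deriveB (is_deriveM (dg i j) (dc k i))
                                      (is_deriveM (dg i i) (dc k j))).
refine (is_derive_eq h _).
rewrite /= pp_off// pp_diag vi.
rewrite /GRing.scale /= !fctE /= pp_off// pp_diag.
ring.
Qed.

End Linearization.

(** * The linearized Gram dynamics at a tetrahedron *)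

Lemma trmx_mulC (R : comNzRingType) m n (A B : 'M[R]_(m, n)) i j :
  (A^T *m B) i j = (B^T *m A) j i.
Proof. by rewrite !mxE; apply: eq_bigr => k _; rewrite !mxE mulrC. Qed.

Section LinearizedGram.
Context (R : realType) (f : R -> R) (b : R).
Hypothesis db : is_derive (- (1 / 3) : R) 1 (f \o acos) b.
Variable p : 'M[R]_(3, 4).
Hypothesis pp : p^T *m p = tetra_gram R.
Local Notation F := (closed_loop complete_graph f).
Local Notation a := (f (acos (- (1 / 3)))).
Local Notation sigma v := (polar_gram p v).
Local Notation r v i := (\sum_j sigma v i j).

Let p_sum (x : 'M[R]_(3, 4)) i : \sum_l (p^T *m x) l i = 0.
Proof.
have := congr1 (fun M : 'cV_3 => (x^T *m M) i 0) (tetra_sum0 _ _ pp).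
rewrite mulmx0 [RHS]mxE mulmxA mxE => e; rewrite -[RHS]e.
by apply: eq_bigr => l _; rewrite [const_mx _ _ _]mxE mulr1 trmx_mulC.
Qed.

Lemma polar_gramE (v : 'M[R]_(3, 4)) i j :
  sigma v i j = (p^T *m v) i j + (p^T *m v) j i.
Proof. by rewrite mxE trmx_mulC addrC. Qed.

(** Row sums of the variation only involve the total velocity,
    because the vertices sum to zero. *)
Lemma polar_gram_row_sum v i : r v i = \sum_j (p^T *m v) i j.
Proof.
under eq_bigr => j _ do rewrite polar_gramE.
by rewrite big_split /= p_sum addr0.
Qed.

(** This constraint on the variations is what turns the equation for
    [r_i] below into a scalar one. *)
Lemma polar_gram_total v : \sum_i r v i = 0.
Proof.
under eq_bigr => i _ do rewrite polar_gram_row_sum.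
by rewrite exchange_big /= big1.
Qed.

(** Pairing of the linearized field with the vertices; its symmetrization is the
    variation of the Gram matrix. *)
Let dual_diff v l i : (forall j, sigma v j j = 0) ->
  (p^T *m 'd F p v) l i =
  b * (- (1 / 3) * r v i * tetra_gram R l i - 4 / 3 * sigma v i l + r v i / 3)
  + a * (r v i * tetra_gram R l i - r v l).
Proof.
move=> v0; rewrite mxE.
under eq_bigr => k _ do rewrite mxE (diff_closed_loopE _ _ _ db _ pp)// mulr_sumr.
rewrite exchange_big /=.
have vii : (p^T *m v) i i = 0.
  by have := v0 i; rewrite polar_gramE => h; lra.
have sT : \sum_j sigma v i j * tetra_gram R l j = 4 / 3 * sigma v i l - r v i / 3.
  rewrite !sum4E; move: l; apply: forall4; rewrite !tetra_gramE /=; by field.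
pose g j := b * sigma v i j * (- (1 / 3) * tetra_gram R l i - tetra_gram R l j)
  + a * (sigma v i j * tetra_gram R l i - 1 / 3 * (p^T *m v) l i - (p^T *m v) l j).
transitivity (\sum_(j | j != i) g j).
  apply: eq_bigr => j _; rewrite /g -pp ![(p^T *m _) l _]mxE !sum3E !mxE.
  by ring.
have -> : \sum_(j | j != i) g j = \sum_j g j - g i.
  by rewrite [in RHS](bigD1 i)//= addrAC subrr add0r.
have -> : \sum_j g j = b * (- (1 / 3) * r v i * tetra_gram R l i
      - \sum_j sigma v i j * tetra_gram R l j)
    + a * (r v i * tetra_gram R l i - 4 / 3 * (p^T *m v) l i - r v l).
  rewrite (polar_gram_row_sum v l) /g !sum4E.
  by field.
rewrite sT /g v0.
have [->|li] := eqVneq l i.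
  by rewrite vii v0 !tetra_gramE eqxx; field.
by rewrite !tetra_gramE (negbTE li); field.
Qed.

(** The field is tangent to the spheres. *)
Lemma polar_gram_diff_diag v i : (forall j, sigma v j j = 0) ->
  sigma ('d F p v) i i = 0.
Proof.
move=> v0; rewrite polar_gramE (dual_diff v i i v0) v0 tetra_gramE eqxx.
by field.
Qed.

Lemma polar_gram_diff v i j : i != j -> (forall k, sigma v k k = 0) ->
  sigma ('d F p v) i j = - (8 / 3 * b) * sigma v i j
    - 4 / 3 * (a - b / 3) * (r v i + r v j).
Proof.
move=> ij v0; rewrite polar_gramE !dual_diff// !tetra_gramE (negbTE ij).
rewrite eq_sym (negbTE ij) (_ : sigma v j i = sigma v i j); first by field.
by rewrite !polar_gramE addrC.
Qed.

Lemma polar_gram_diff_row_sum v i : (forall k, sigma v k k = 0) ->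
  r ('d F p v) i = - (8 / 3 * (a + 2 / 3 * b)) * r v i.
Proof.
move=> v0; rewrite (bigD1 i)//= polar_gram_diff_diag// add0r.
under eq_bigr => j ji do rewrite polar_gram_diff// 1?eq_sym//.
have tot : \sum_(j | j != i) r v j = - r v i.
  by have := polar_gram_total v; rewrite (bigD1 i)//= => /eqP; rewrite addrC addr_eq0 => /eqP.
have own : \sum_(j | j != i) sigma v i j = r v i.
  by rewrite [RHS](bigD1 i)//= v0 add0r.
rewrite sumrB -!mulr_sumr own big_split /= tot sumr_const cardC1 card_ord /=.
by field.
Qed.
End LinearizedGram.

(** * Tangent spaces *)

Lemma is_derive_gram_curve (R : realType) m n (gamma : R -> 'M[R]_(m, n))
    (t : R) (v : 'M[R]_(m, n)) i j :
  is_derive t 1 gamma v ->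
  is_derive t 1 (fun s => ((gamma s)^T *m gamma s) i j)
    (polar_gram (gamma t) v i j).
Proof.
move=> dg; have dg1 : differentiable gamma t.
  by apply/derivable1_diffP; exact: ex_derive.
have dc : differentiable
    ((fun G : 'M[R]_(m, n) => (G^T *m G) i j : R) \o gamma) t.
  by apply: differentiable_comp => //; exact: differentiable_gram.
apply: DeriveDef; first by apply/derivable1_diffP; exact: dc.
rewrite (@deriveE _ _ _ _ _ (1 : R) dc) diff_comp//=; last exact: differentiable_gram.
by rewrite diff_gram -deriveE// derive_val.
Qed.

(** Differentiate the constant function [c_ij] along a curve in [M]. *)
Lemma tangent_gram_const (R : realType) m n (M : set 'M[R]_(m, n)) p v c i j :
  (forall G, M G -> (G^T *m G) i j = c) -> tangent_space M p v ->
  polar_gram p v i j = 0.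
Proof.
move=> Mc [gamma [<- nM dg]].
have := is_derive_gram_curve R m n gamma 0 v i j dg.
have : is_derive (0 : R) 1 (fun s => ((gamma s)^T *m gamma s) i j) 0.
  have dc := is_derive_cst c (0 : R) (1 : R).
  apply: near_eq_is_derive dc.
  by near=> t; rewrite /cst; apply/esym/Mc; near: t.
by move=> [_ e0] [_ e1]; rewrite -e1.
Unshelve. all: by end_near. Qed.

Lemma tangent_spaceS (R : realType) (V : normedModType R) (M N : set V) p :
  M `<=` N -> tangent_space M p `<=` tangent_space N p.
Proof.
move=> MN v [gamma [g0 gM dg]]; exists gamma; split => //.
by apply: filterS gM => t; exact: MN.
Qed.

Lemma tangent_space0 (R : realType) (V : normedModType R) (M : set V) p :
  M p -> tangent_space M p 0.
Proof.
move=> Mp; exists (cst p); split => //; last exact: is_derive_cst.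
by apply: filterE => t.
Qed.

Lemma is_derive_scalel (R : realType) (V : normedModType R) (k : R -> R) (t dk : R)
    (v : V) :
  is_derive t 1 k dk -> is_derive t 1 (fun s => k s *: v) (dk *: v).
Proof.
move=> dkt; have dk1 : differentiable k t.
  by apply/derivable1_diffP; exact: ex_derive.
have dkv := differentiableZl v dk1.
apply: DeriveDef; first exact: diff_derivable.
by rewrite deriveE// diffZl// -deriveE// derive_val.
Qed.

(** Cayley-Hamilton for a skew [S]; [n] is the squared norm of the
    rotation vector.  It makes the rotation curve below a rational function
    of time. *)
Lemma skew3_cube (R : realType) (S : 'M[R]_3) : S^T = - S ->
  exists n, 0 <= n /\ S *m S *m S = - n *: S.
Proof.
move=> /matrixP ST.
have e i j : S i j = - S j i by have := ST j i; rewrite !mxE.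
have d0 i : S i i = 0 by have := e i i; lra.
exists (S 0 1 ^+ 2 + S 0 2%:R ^+ 2 + S 1 2%:R ^+ 2); split.
  by rewrite !addr_ge0 ?sqr_ge0.
apply/matrixP => i j; rewrite mxE sum3E !mxE !sum3E.
by move: i j; apply: forall3; apply: forall3;
  rewrite ?d0 (e 1 0) (e 2%:R 0) (e 2%:R 1); ring.
Qed.

(** The curve is [Q(t) p], where [Q(t)] is the Cayley transform of
    [t S / 2].  By [skew3_cube] it equals
    [1 + g (t) (t S + t^2 S^2 / 2)] with [g (t) = 1 / (1 + n t^2 / 4)], so no
    matrix has to be inverted. *)
Lemma skew_tangent (R : realType) (p : 'M[R]_(3, 4)) (S : 'M[R]_3) :
  Omega_T p -> S^T = - S -> tangent_space Omega_T p (S *m p).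
Proof.
move=> /Omega_TP pp ST; have [n [n0 S3]] := skew3_cube R S ST.
pose g (t : R) := (1 + n / 4 * t ^+ 2)^-1.
have g1 t : 1 + n / 4 * t ^+ 2 != 0.
  by rewrite gt_eqF// ltr_pwDl// mulr_ge0 ?sqr_ge0// divr_ge0.
pose gamma t := p + ((t * g t) *: (S *m p) + (t * (t * g t) / 2) *: (S *m S *m p)).
exists gamma; split.
- by rewrite /gamma !mul0r !scale0r !addr0.
- apply: filterE => t; apply/Omega_TP; rewrite -pp.
  pose Q := 1%:M + ((t * g t) *: S + (t * (t * g t) / 2) *: (S *m S)).
  have -> : gamma t = Q *m p by rewrite /gamma /Q !mulmxDl mul1mx -!scalemxAl.
  suff QQ : Q^T *m Q = 1%:M by rewrite trmx_mul mulmxA -(mulmxA p^T) QQ mulmx1.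
  have -> : Q^T = 1%:M + (- (t * g t) *: S + (t * (t * g t) / 2) *: (S *m S)).
    rewrite /Q; move: (t * g t) (t * (t * g t) / 2) => c1 c2.
    rewrite !linearD !linearZ /= trmx1 trmx_mul ST mulmxN mulNmx opprK.
    by rewrite scalerN scaleNr.
  rewrite /Q !mulmxDl !mulmxDr !mul1mx !mulmx1 -!scalemxAl -!scalemxAr !mulmxA S3.
  rewrite -!scalemxAl; apply/matrixP => i j; rewrite !mxE.
  rewrite /g; field.
  by rewrite gt_eqF// ltr_pwDl// mulr_ge0// sqr_ge0.
- have dg : derivable g 0 1.
    apply: derivableV; first exact: g1.
    by apply: derivableD => //; apply: derivableM => //; exact: exprn_derivable.
  have dt := is_derive_id (0 : R) (1 : R).
  have d1 := is_deriveM dt (derivableP dg).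
  have d2 := is_deriveM dt d1.
  have g0 : g 0 = 1 by rewrite /g expr0n /= mulr0 addr0 invr1.
  have d1' : is_derive (0 : R) 1 (fun t => t * g t) 1.
    refine (is_derive_eq d1 _).
    by rewrite /= scale0r add0r g0 scale1r.
  have d2' : is_derive (0 : R) 1 (fun t => t * (t * g t) / 2) 0.
    have d3 := is_deriveM d2 (is_derive_cst (2^-1 : R) (0 : R) (1 : R)).
    refine (is_derive_eq d3 _).
    by rewrite /= !fctE /= !mul0r !scale0r !add0r scaler0.
  have d := is_deriveD (is_derive_cst p (0 : R) (1 : R))
    (is_deriveD (is_derive_scalel R _ _ _ _ (S *m p) d1')
      (is_derive_scalel R _ _ _ _ (S *m S *m p) d2')).
  refine (is_derive_eq d _).
  by rewrite add0r scale1r scale0r addr0.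
Qed.

(** If [sigma = 0], then [v 1 = 0] by pairing with the vertices, and the
    tight frame identity gives [v = S p] for [S = (3/4) v p^T], which is
    skew because [p (v^T p + p^T v) p^T = 0]. *)
Lemma tangent_Omega_T (R : realType) (p : 'M[R]_(3, 4)) : Omega_T p ->
  tangent_space Omega_T p = [set v | polar_gram p v = 0].
Proof.
move=> Op; have /Omega_TP pp := Op; apply/seteqP; split=> [v tv|v /= v0].
  apply/matrixP => i j; rewrite [RHS]mxE.
  apply: (tangent_gram_const _ _ _ _ _ _ (tetra_gram R i j) _ _ _ tv).
  by move=> G /Omega_TP ->.
have p1 := tetra_sum0 _ _ pp; have pTp := tetra_frame _ _ pp.
have v1 : v *m const_mx 1 = 0 :> 'cV_3.
  have : p *m (polar_gram p v *m const_mx 1 : 'cV_4) = 0.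
    by rewrite v0 mul0mx mulmx0.
  rewrite mulmxDl mulmxDr -mulmxA p1 mulmx0 mulmx0 add0r !mulmxA pTp.
  rewrite -mulmxA mul_scalar_mx => /eqP; rewrite scaler_eq0 => /orP[|/eqP//].
  by rewrite gt_eqF// divr_gt0.
(* [S p = (3/4) v T = v - (1/4) v 1 1^T], and the last term vanishes. *)
have vS : v = ((3 / 4) *: (v *m p^T)) *m p.
  rewrite -scalemxAl -mulmxA pp mulmxBr mul_mx_scalar.
  have -> : const_mx (1 / 3) = const_mx 1 *m ((1 / 3) *: const_mx 1 : 'rV_4)
      :> 'M[R]_4.
    by apply/matrixP => i j; rewrite !mxE big_ord1 !mxE mulr1 [RHS]mul1r.
  rewrite mulmxA v1 mul0mx subr0 scalerA (_ : 3 / 4 * (4 / 3) = 1) ?scale1r//.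
  by field.
rewrite vS; apply: skew_tangent => //.
rewrite linearZ /= trmx_mul trmxK -scalerN; congr (_ *: _).
have : p *m polar_gram p v *m p^T = 0 by rewrite v0 mulmx0 mul0mx.
rewrite mulmxDr mulmxDl !mulmxA pTp -!mulmxA pTp !mul_scalar_mx mul_mx_scalar.
rewrite -scalemxAr -scalerDr => /eqP; rewrite scaler_eq0 => /orP[|].
  by rewrite gt_eqF// divr_gt0.
by rewrite addr_eq0 => /eqP.
Qed.

(** * The center subspace *)

(** The hypotheses say [(- k - i m) (X + i Y) = 0], and [- k] is not
    purely imaginary. *)
Lemma real_rate_not_imaginary (R : realType) (k m X Y : R) : 0 < k ->
  - k * X + m * Y = 0 -> - k * Y - m * X = 0 -> X = 0 /\ Y = 0.
Proof.
move=> k0 h1 h2.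
have h : k * (X ^+ 2 + Y ^+ 2) = 0.
  have -> : k * (X ^+ 2 + Y ^+ 2) = - X * (- k * X + m * Y) - Y * (- k * Y - m * X).
    by ring.
  by rewrite h1 h2; ring.
move/eqP: h; rewrite mulf_eq0 gt_eqF//= paddr_eq0 ?sqr_ge0// !sqrf_eq0.
by move=> /andP[/eqP -> /eqP ->].
Qed.

Lemma polar_gram_comb (R : realType) m n (p u v : 'M[R]_(m, n)) c i j :
  polar_gram p (u + c *: v) i j =
  polar_gram p u i j + c * polar_gram p v i j.
Proof.
rewrite /polar_gram linearD linearZ /= mulmxDl mulmxDr -scalemxAl -scalemxAr.
by rewrite !mxE; ring.
Qed.

Lemma polar_gram0 (R : realType) m n (p : 'M[R]_(m, n)) :
  polar_gram p 0 = 0.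
Proof. by rewrite /polar_gram trmx0 mul0mx mulmx0 addr0. Qed.

(** A complex vector is encoded by its real and imaginary parts; on such
    pairs this is the operator [L - i m]. *)
Definition complex_shift {R : realType} {V : lmodType R} (L : V -> V) (m : R)
  (w : V * V) : V * V := (L w.1 + m *: w.2, L w.2 + (- m) *: w.1).

Section CenterVectors.
Context (R : realType) (f : R -> R) (b : R).
Hypothesis a0 : 0 < f (acos (- (1 / 3))).
Hypothesis b0 : 0 < b.
Hypothesis db : is_derive (- (1 / 3) : R) 1 (f \o acos) b.
Variable p : 'M[R]_(3, 4).
Hypothesis pp : p^T *m p = tetra_gram R.
Local Notation F := (closed_loop complete_graph f).
Local Notation a := (f (acos (- (1 / 3)))).
Local Notation sigma v := (polar_gram p v).

(** Induct on the exponent annihilating [w]: by induction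
    [(L - i m) w] has zero variation of Gram matrix.  On the row sums
    of [sigma w] the operator [L] then acts both as a negative real number and
    as [i m], so they vanish; after that the same holds for the entries. *)
Lemma generalized_center_tangent m N (w : 'M[R]_(3, 4) * 'M[R]_(3, 4)) :
  (forall j, sigma w.1 j j = 0) -> (forall j, sigma w.2 j j = 0) ->
  iter N (complex_shift ('d F p) m) w = (0, 0) ->
  sigma w.1 = 0 /\ sigma w.2 = 0.
Proof.
elim: N w => [|N IH] w w1 w2; first by move=> /= ->; rewrite polar_gram0.
rewrite iterSr => hN; have [j|j|s1 s2] := IH _ _ _ hN.
- rewrite polar_gram_comb w2 mulr0 addr0.
  exact: (polar_gram_diff_diag _ _ _ db _ pp).
- rewrite polar_gram_comb w1 mulr0 addr0.
  exact: (polar_gram_diff_diag _ _ _ db _ pp).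
have e1 i j : sigma ('d F p w.1) i j + m * sigma w.2 i j = 0.
  by rewrite -polar_gram_comb [LHS](congr1 (fun M : 'M[R]_4 => M i j) s1) mxE.
have e2 i j : sigma ('d F p w.2) i j + - m * sigma w.1 i j = 0.
  by rewrite -polar_gram_comb [LHS](congr1 (fun M : 'M[R]_4 => M i j) s2) mxE.
have r0 i : \sum_j sigma w.1 i j = 0 /\ \sum_j sigma w.2 i j = 0.
  apply: (@real_rate_not_imaginary R (8 / 3 * (a + 2 / 3 * b)) m).
  - by rewrite mulr_gt0 ?divr_gt0 ?addr_gt0 ?mulr_gt0 ?divr_gt0.
  - rewrite -(polar_gram_diff_row_sum _ _ _ db _ pp)// mulr_sumr -big_split /=.
    by rewrite big1.
  - rewrite -(polar_gram_diff_row_sum _ _ _ db _ pp)// -mulNr mulr_sumr.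
    by rewrite -big_split /= big1.
have s0 i j : sigma w.1 i j = 0 /\ sigma w.2 i j = 0.
  have [->|ij] := eqVneq i j; first by [].
  apply: (@real_rate_not_imaginary R (8 / 3 * b) m).
  - by rewrite mulr_gt0 ?divr_gt0.
  - have := e1 i j; rewrite (polar_gram_diff _ _ _ db _ pp)//.
    by rewrite (r0 i).1 (r0 j).1 addr0 mulr0 subr0.
  - have := e2 i j; rewrite (polar_gram_diff _ _ _ db _ pp)//.
    by rewrite (r0 i).2 (r0 j).2 addr0 mulr0 subr0 !mulNr.
by split; apply/matrixP => i j; rewrite [RHS]mxE; have [] := s0 i j.
Qed.

(** The field vanishes along any curve in [Omega_T]. *)
Lemma diff_tetra_tangent v : tangent_space Omega_T p v -> 'd F p v = 0.
Proof.
move=> [gamma [g0 gO dg]].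
have dF : differentiable F p := differentiable_closed_loop _ _ _ db _ pp.
have dg1 : differentiable gamma 0 by apply/derivable1_diffP; exact: ex_derive.
have dFg : 'd (F \o gamma) 0 1 = 'd F p v.
  rewrite diff_comp ?g0//= -(deriveE _ dg1).
  by rewrite (@derive_val _ _ _ _ _ _ _ dg).
have d0 : is_derive (0 : R) 1 (F \o gamma) 0.
  apply: near_eq_is_derive (is_derive_cst (0 : 'M[R]_(3, 4)) (0 : R) (1 : R)).
  near=> t; rewrite /cst /=; apply/esym/closed_loop_tetra/Omega_TP.
  by near: t.
rewrite -dFg -deriveE; first exact: derive_val.
by apply: differentiable_comp => //; rewrite g0.
Unshelve. all: by end_near. Qed.

End CenterVectors.

Lemma Re_sum (R : realType) (I : Type) (r : seq I) (F : I -> R[i]) :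
  complex.Re (\sum_(k <- r) F k) = \sum_(k <- r) complex.Re (F k).
Proof. by apply: (big_morph (@complex.Re R)) => // -[? ?] [? ?]. Qed.

Lemma Im_sum (R : realType) (I : Type) (r : seq I) (F : I -> R[i]) :
  complex.Im (\sum_(k <- r) F k) = \sum_(k <- r) complex.Im (F k).
Proof. by apply: (big_morph (@complex.Im R)) => // -[? ?] [? ?]. Qed.

Definition complex_parts {R : realType} {m n} (w : 'rV[R[i]]_(m * n)) :
    'M[R]_(m, n) * 'M[R]_(m, n) :=
  (vec_mx (map_mx (@complex.Re R) w), vec_mx (map_mx (@complex.Im R) w)).

Lemma complex_parts_shift (R : realType) m n (L : {linear 'M[R]_(m, n) -> 'M[R]_(m, n)})
    (mu : R[i]) (w : 'rV[R[i]]_(m * n)) : complex.Re mu = 0 ->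
  complex_parts (w *m (map_mx (real_complex R) (lin_mx L) - mu%:M)) =
  complex_shift L (complex.Im mu) (complex_parts w).
Proof.
case: mu => [_ y] /= ->.
rewrite /complex_parts /complex_shift /= -!(mx_rV_lin L) mulmxBr mul_mx_scalar.
by congr (_, _); apply/matrixP => i j; rewrite !mxE ?raddfB /= ?Re_sum ?Im_sum;
  (congr (_ + _); first (apply: eq_bigr => l _; rewrite !mxE));
  case: (w 0 _) => u v /=; ring.
Qed.

Lemma geigenspace_parts (R : realType) m n (L : {linear 'M[R]_(m.+1, n.+1) -> 'M[R]_(m.+1, n.+1)})
    (mu : R[i]) (w : 'rV[R[i]]_(m.+1 * n.+1)) : complex.Re mu = 0 ->
  (w <= geigenspace (map_mx (real_complex R) (lin_mx L)) mu)%MS ->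
  exists N, iter N (complex_shift L (complex.Im mu)) (complex_parts w) = (0, 0).
Proof.
move=> mu0; rewrite geigenspaceE => /sub_kermxP h.
exists (m.+1 * n.+1)%N; move: h; set N := (X in _ ^+ X).
rewrite -[X in iter X]/N; elim: N w => [|N IH] w.
  by rewrite expr0 mulmx1 => ->; rewrite /= /complex_parts !map_mx0 linear0.
by rewrite exprS mulmxA => /IH; rewrite complex_parts_shift// iterSr.
Qed.

Lemma Omega_T_formations (R : realType) : @Omega_T R `<=` formations.
Proof. by move=> G []. Qed.

Lemma tangent_center (R : realType) (f : R -> R) (b : R) (p : 'M[R]_(3, 4)) :
  0 < f (acos (- (1 / 3))) -> 0 < b ->
  is_derive (- (1 / 3) : R) 1 (f \o acos) b -> Omega_T p ->
  tangent_space Omega_T p =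
  center_subspace formations (closed_loop complete_graph f) p.
Proof.
move=> a0 b0 db Op; have /Omega_TP pp := Op.
apply/seteqP; split=> [v tv|v].
  exists 1%N, (fun=> 0), (fun=> map_mx (real_complex R) (mxvec v)).
  split; last by rewrite big_ord1.
  move=> _; have dv := diff_tetra_tangent _ _ _ db _ pp _ tv; split => //.
  - apply: submx_trans (eigenspace_sub_geigen _ _).
    apply/eigenspaceP; rewrite scale0r -map_mxM mul_vec_lin dv.
    by rewrite linear0 map_mx0.
  - rewrite (_ : vec_mx _ = v).
      exact: tangent_spaceS (@Omega_T_formations R) _ tv.
    by apply/matrixP => i j; rewrite !mxE mxvecE.
  - rewrite (_ : vec_mx _ = 0).
      by apply: tangent_space0; exact: Omega_T_formations.
    by apply/matrixP => i j; rewrite !mxE.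
move=> [l [mu [w [hw vw]]]].
rewrite tangent_Omega_T//=.
have sw k : polar_gram p (vec_mx (map_mx (@complex.Re R) (w k))) = 0.
  have [mu0 wg tRe tIm] := hw k.
  have [N hN] := geigenspace_parts R 2 3 _ _ _ mu0 wg.
  have diag u : tangent_space formations p u -> forall j, polar_gram p u j j = 0.
    move=> tu j; apply: (tangent_gram_const _ _ _ _ _ _ 1 _ _ _ tu).
    by move=> G /formationsP.
  have [] := generalized_center_tangent _ _ _ a0 b0 db _ pp _ _ _ _ _ hN => //.
  - exact: diag.
  - exact: diag.
have vE : v = \sum_k vec_mx (map_mx (@complex.Re R) (w k)).
  apply/matrixP => i j; rewrite summxE.
  have := congr1 (fun M : 'rV_(3 * 4) => complex.Re (M 0 (mxvec_index i j))) vw.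
  rewrite mxE mxvecE /= => ->; rewrite summxE Re_sum.
  by apply: eq_bigr => k _; rewrite !mxE.
rewrite vE; elim/big_ind : _ => //; first exact: polar_gram0.
move=> x y /matrixP hx /matrixP hy; apply/matrixP => i j.
by rewrite -[y]scale1r polar_gram_comb hx hy !mxE; ring.
Qed.

(** * Regular tetrahedra form a submanifold *)

(** Polynomials in the entries, as functions: the class is visibly stable
    under directional derivatives, hence consists of smooth functions. *)
Inductive polyfun {R : realType} {m n : nat} : ('M[R]_(m, n) -> R) -> Prop :=
| polyfun_cst c : polyfun (fun=> c)
| polyfun_coord i j : polyfun (fun M => M i j)
| polyfun_add g h : polyfun g -> polyfun h -> polyfun (fun M => g M + h M)
| polyfun_mul g h : polyfun g -> polyfun h -> polyfun (fun M => g M * h M).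

Section Polyfun.
Context (R : realType) (m n : nat).
Local Notation V := 'M[R]_(m, n).

Lemma polyfun_sum (I : Type) (r : seq I) (P : pred I) (h : I -> V -> R) :
  (forall i, P i -> polyfun (h i)) ->
  polyfun (fun M => \sum_(i <- r | P i) h i M).
Proof.
move=> ph; elim: r => [|i r IH].
  by under eq_fun do rewrite big_nil; exact: polyfun_cst.
case Pi : (P i); under eq_fun do rewrite big_cons Pi; last exact: IH.
by apply: polyfun_add => //; exact: ph.
Qed.

Lemma polyfun_prod (I : Type) (r : seq I) (P : pred I) (h : I -> V -> R) :
  (forall i, P i -> polyfun (h i)) ->
  polyfun (fun M => \prod_(i <- r | P i) h i M).
Proof.
move=> ph; elim: r => [|i r IH].
  by under eq_fun do rewrite big_nil; exact: polyfun_cst.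
case Pi : (P i); under eq_fun do rewrite big_cons Pi; last exact: IH.
by apply: polyfun_mul => //; exact: ph.
Qed.

Lemma differentiable_polyfun (g : V -> R) x : polyfun g -> differentiable g x.
Proof.
elim=> [c|i j|g1 g2 _ d1 _ d2|g1 g2 _ d1 _ d2].
- exact: differentiable_cst.
- exact: differentiable_coord.
- exact: (differentiableD d1 d2).
- exact: (differentiableM d1 d2).
Qed.

Lemma polyfun_derive (g : V -> R) v : polyfun g -> polyfun (fun x => 'D_v g x).
Proof.
elim=> [c|i j|g1 g2 p1 d1 p2 d2|g1 g2 p1 d1 p2 d2].
- under eq_fun => x do rewrite derive_cst.
  exact: polyfun_cst.
- under eq_fun => x do rewrite (@derive_val _ _ _ _ _ _ _ (is_derive_coord R m n x v i j)).
  exact: polyfun_cst.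
- rewrite (_ : (fun x => _) = fun x => 'D_v g1 x + 'D_v g2 x).
    exact: polyfun_add.
  by apply/funext => x; apply: deriveD; apply: diff_derivable;
    exact: differentiable_polyfun.
- rewrite (_ : (fun x => _) = fun x => g1 x * 'D_v g2 x + g2 x * 'D_v g1 x).
    by apply: polyfun_add; apply: polyfun_mul.
  by apply/funext => x; apply: deriveM; apply: diff_derivable;
    exact: differentiable_polyfun.
Qed.

Lemma smooth_polyfun (U : set V) (g : V -> R) : polyfun g -> smooth_on U g.
Proof.
move=> pg k; elim: k g pg => [|k IH] g pg /=.
  by move=> x _; apply: differentiable_continuous; exact: differentiable_polyfun.
split=> [x _|v]; first exact: differentiable_polyfun.
by apply: IH; exact: polyfun_derive.
Qed.

Lemma polyfun_gram i j : polyfun (fun M : V => (M^T *m M) i j).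
Proof.
under eq_fun do rewrite mxE.
apply: polyfun_sum => k _; under eq_fun do rewrite mxE.
by apply: polyfun_mul; exact: polyfun_coord.
Qed.

End Polyfun.

Section Submanifold.
Context (R : realType).
Local Notation V := 'M[R]_(3, 4).
Local Notation base x := (@lsubmx _ 3 3 1 (x : 'M[R]_(3, 3 + 1))).
Local Notation ones := (const_mx 1 : 'cV[R]_4).

(** The symmetric part prescribes the Gram matrix of the first three
    vertices (six equations), the skew part says that the four vertices sum
    to zero (three equations).  Bundling both in one matrix makes the nine
    equations independent: the ten Gram conditions are not, since the Gram
    determinant of four vectors of the space is always zero. *)
Definition tetra_eqs (x : V) : 'M[R]_3 :=
  (base x)^T *m base x - ((4 / 3)%:M - const_mx (1 / 3)) + hat (x *m ones).

Let hat_linear (u : 'cV[R]_3) i j :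
  hat u i j = \sum_k u k 0 * hat (delta_mx k 0 : 'cV[R]_3) i j.
Proof.
by rewrite sum3E; move: i j; apply: forall3; apply: forall3; rewrite !mxE /=; ring.
Qed.

Let base_gram (x : V) i j :
  ((base x)^T *m base x) i j = (x^T *m x) (lshift 1 i) (lshift 1 j).
Proof. by rewrite !mxE; apply: eq_bigr => k _; rewrite !mxE. Qed.

Lemma polyfun_tetra_eqs i j : polyfun (fun x : V => tetra_eqs x i j : R).
Proof.
under eq_fun => x do rewrite mxE mxE base_gram hat_linear.
apply: polyfun_add; first (apply: polyfun_add; first exact: polyfun_gram).
  exact: polyfun_cst.
apply: polyfun_sum => k _; apply: polyfun_mul; last exact: polyfun_cst.
under eq_fun => x do rewrite mxE.
apply: polyfun_sum => l _; apply: polyfun_mul; first exact: polyfun_coord.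
exact: polyfun_cst.
Qed.

Lemma diff_tetra_eqs (x h : V) i j : 'd (fun x => tetra_eqs x i j : R) x h =
  (polar_gram (base x) (base h) + hat (h *m ones)) i j.
Proof.
have dt := differentiable_polyfun _ _ _ _ x (polyfun_tetra_eqs i j).
rewrite -(deriveE _ dt); apply: derive_val.
under eq_fun => y do rewrite mxE mxE base_gram hat_linear.
have d1 := is_derive_gram R 3 4 x h (lshift 1 i) (lshift 1 j).
have d2 := is_derive_cst ((- ((4 / 3)%:M - const_mx (1 / 3) : 'M[R]_3)) i j) x h.
have d3 : is_derive x h
    (fun y : V => \sum_k (y *m ones) k 0 * hat (delta_mx k 0 : 'cV[R]_3) i j)
    (\sum_k (h *m ones) k 0 * hat (delta_mx k 0 : 'cV[R]_3) i j).
  apply: is_derive_bigsum => k _.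
  have dk : is_derive x h (fun y : V => (y *m ones) k 0) ((h *m ones) k 0).
    under eq_fun => y do rewrite mxE.
    rewrite mxE; apply: is_derive_bigsum => l _.
    under eq_fun => y do rewrite mxE mulr1.
    by rewrite mxE mulr1; exact: is_derive_coord.
  have := is_deriveM dk (is_derive_cst (hat (delta_mx k 0 : 'cV[R]_3) i j) x h).
  move=> dh; refine (is_derive_eq dh _).
  by rewrite scaler0 add0r /GRing.scale /= mulrC.
refine (is_derive_eq (is_deriveD (is_deriveD d1 d2) d3) _).
rewrite addr0 -hat_linear [RHS]mxE; congr (_ + _).
by rewrite !mxE; congr (_ + _); apply: eq_bigr => k _; rewrite !mxE.
Qed.

(** Split [Y = S + K] into symmetric and skew parts.  With [A] the first
    three columns of [x], the choice [H = A^-T S / 2] gives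
    [H^T A + A^T H = S], and the last column is then free to realize [K]. *)
Lemma diff_tetra_eqs_surj (x : V) (Y : 'M[R]_3) : base x \in unitmx ->
  exists h : V, polar_gram (base x) (base h) + hat (h *m ones) = Y.
Proof.
move=> ux; pose S := 2^-1 *: (Y + Y^T).
pose H : 'M[R]_3 := invmx (base x)^T *m (2^-1 *: S).
pose u : 'cV[R]_3 := \col_i nth 0
  [:: (Y 2%:R 1 - Y 1 2%:R) / 2; (Y 0 2%:R - Y 2%:R 0) / 2; (Y 1 0 - Y 0 1) / 2] i.
pose h : V := row_mx H (u - H *m const_mx 1).
exists h; have bh : base h = H by exact: row_mxKl.
have c1 (A : 'cV[R]_3) : A *m (const_mx 1 : 'cV_1) = A.
  by apply/matrixP => i j; rewrite !mxE big_ord1 !mxE mulr1 (ord1 j).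
have hu : h *m ones = u.
  rewrite (_ : ones = col_mx (const_mx 1 : 'cV_3) (const_mx 1 : 'cV_1)).
    by rewrite [LHS](mul_row_col H) c1 addrC subrK.
  by rewrite col_mx_const.
have aH : (base x)^T *m H = 2^-1 *: S by rewrite mulKVmx// unitmx_tr.
have Ha : H^T *m base x = 2^-1 *: S.
  rewrite -[LHS]trmxK trmx_mul trmxK aH linearZ /= /S linearZ linearD /= trmxK.
  by rewrite addrC.
rewrite /polar_gram bh aH Ha hu.
apply/matrixP => i j; rewrite !mxE.
by move: i j; apply: forall3; apply: forall3 => /=; field.
Qed.

Lemma tetra_eqsP (x : V) : Omega_T x <-> tetra_eqs x = 0.
Proof.
rewrite Omega_TP; split=> [xx|/matrixP e].
  rewrite /tetra_eqs (tetra_sum0 _ _ xx).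
  apply/matrixP => i j; rewrite mxE [in LHS]mxE base_gram xx !mxE.
  by move: i j; apply: forall3; apply: forall3; rewrite /= ; ring.
(* Adding and subtracting the equations at (i, j) and (j, i) separates the Gram
   conditions from the components of the sum of the vertices. *)
have eg (i j : 'I_3) : (x^T *m x) (lshift 1 i) (lshift 1 j) = tetra_gram R (lshift 1 i) (lshift 1 j).
  have e1 := e i j; have e2 := e j i; move: e1 e2.
  rewrite /tetra_eqs mxE [in LHS]mxE base_gram => e1.
  rewrite mxE [in LHS]mxE base_gram trmx_mulC.
  move: e1; rewrite !mxE.
  by move: i j; apply: forall3; apply: forall3; rewrite /= => h1 h2; lra.
have x1 : x *m ones = 0.
  have hu i j : hat (x *m ones) i j = 0.
    have := e i j; rewrite mxE [in LHS]mxE base_gram eg.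
    by move: i j; apply: forall3; apply: forall3; rewrite !mxE /= => h; lra.
  apply/matrixP => i j; rewrite ord1 [RHS]mxE.
  have := hu 2%:R 1; have := hu 0 2%:R; have := hu 1 0.
  rewrite /hat !mxE /= => h2 h1 h0.
  by move: i; apply: forall3.
have row i : (x^T *m x) i 0 + (x^T *m x) i 1 + (x^T *m x) i 2%:R
    + (x^T *m x) i 3%:R = 0.
  have := congr1 (fun M : 'cV_3 => (x^T *m M) i 0) x1.
  by rewrite mulmx0 [RHS]mxE mulmxA mxE sum4E ![ones _ _]mxE !mulr1.
have eg4 (i j : 'I_3) : forall k l : 'I_4, k = i :> nat -> l = j :> nat ->
    (x^T *m x) k l = tetra_gram R k l.
  move=> k l ki lj; have ki' : k = lshift 1 i by apply/val_inj; exact: ki.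
  have lj' : l = lshift 1 j by apply/val_inj; exact: lj.
  by rewrite ki' lj'; exact: eg.
have eg' : forall k l : 'I_4, (k < 3)%N -> (l < 3)%N ->
    (x^T *m x) k l = tetra_gram R k l.
  by move=> k l k3 l3; exact: (eg4 (Ordinal k3) (Ordinal l3)).
have col3 (k : 'I_4) : (k < 3)%N -> (x^T *m x) k 3%:R = tetra_gram R k 3%:R.
  move=> k3; have := row k; rewrite (eg' k 0)// (eg' k 1)// (eg' k 2%:R)// => /eqP.
  rewrite addrC addr_eq0 => /eqP ->.
  by move: k k3; apply: forall4 => //= _; rewrite !tetra_gramE /=; field.
apply/matrixP => i j.
have [i3|i3] := ltnP i 3; have [j3|j3] := ltnP j 3.
- exact: eg'.
- by move: j j3; apply: forall4 => //= _; exact: col3.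
- move: i i3; apply: forall4 => //= _.
  by rewrite trmx_mulC col3// !tetra_gramE eq_sym.
- move: i i3 j j3; apply: forall4 => //= _; apply: forall4 => //= _.
  have := row 3%:R; rewrite (trmx_mulC _ _ _ x x 3%:R 0) (trmx_mulC _ _ _ x x 3%:R 1) (trmx_mulC _ _ _ x x 3%:R 2%:R) (col3 0)// (col3 1)// (col3 2%:R)// => /eqP.
  rewrite addrC addr_eq0 => /eqP ->.
  by rewrite !tetra_gramE /=; field.
Qed.

Lemma base_unit (x : V) : Omega_T x -> base x \in unitmx.
Proof.
move=> /tetra_eqsP/matrixP e.
have e1 : (base x)^T *m base x = (4 / 3)%:M - const_mx (1 / 3).
  have Ox : Omega_T x by apply/tetra_eqsP/matrixP.
  move: Ox => /Omega_TP xx.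
  by apply/matrixP => i j; rewrite base_gram xx !mxE; move: i j; apply: forall3; apply: forall3.
(* The inverse of [4/3 - J/3], where [J] is the all-ones matrix with
   [J^2 = 3 J]. *)
have h : ((3 / 4) *: (1%:M + const_mx 1) *m (base x)^T) *m base x = 1%:M.
  rewrite -mulmxA e1; apply/matrixP => i j; rewrite mxE sum3E !mxE.
  by move: i j; apply: forall3; apply: forall3 => /=; field.
by have [] := mulmx1_unit h.
Qed.

Lemma open_base_unit : open [set x : V | base x \in unitmx].
Proof.
have pdet : polyfun (fun x : V => \det (base x)).
  rewrite /determinant; apply: polyfun_sum => s _.
  apply: polyfun_mul; first exact: polyfun_cst.
  by apply: polyfun_prod => i _; under eq_fun do rewrite mxE; exact: polyfun_coord.
rewrite (_ : [set _ | _] = (fun x : V => \det (base x) : R) @^-1` [set r | r != 0]).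
  apply: open_comp; last exact: open_neq.
  by move=> x _; apply: differentiable_continuous; exact: differentiable_polyfun.
by apply/seteqP; split=> x /=; rewrite unitmxE unitfE.
Qed.

Lemma submanifold_Omega_T : exists c, submanifold c (@Omega_T R).
Proof.
(* The equations are indexed by the entries of a square matrix of size 3. *)
exists (3 * 3)%N => p Op.
exists [set x : V | base x \in unitmx], (fun k x => mxvec (tetra_eqs x) 0 k).
split.
- exact: open_base_unit.
- exact: base_unit.
- move=> k; apply: smooth_polyfun; case/mxvec_indexP: k => i j.
  by under eq_fun do rewrite mxvecE; exact: polyfun_tetra_eqs.
- move=> x ux y.
  have [h hY] := diff_tetra_eqs_surj x (vec_mx (\row_k y k)) ux.
  exists h; case/mxvec_indexP => i j.
  have -> : (fun x => mxvec (tetra_eqs x) 0 (mxvec_index i j)) =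
      (fun x => tetra_eqs x i j) by apply/funext => z; rewrite mxvecE.
  by rewrite diff_tetra_eqs hY !mxE.
- move=> x _; rewrite tetra_eqsP; split=> [-> k|e].
    by rewrite linear0 mxE.
  by apply: (can_inj mxvecK); apply/rowP => k; rewrite e linear0 mxE.
Qed.

End Submanifold.

(** * Dissipation of the Gram defect *)

(** The value [h = 0] is included because single entries of the defect may
    vanish away from the tetrahedra. *)
Lemma derive_approx (R : realType) (phi : R -> R) (x b eta : R) :
  is_derive x 1 phi b -> 0 < eta ->
  exists2 d, 0 < d & forall h, `|h| < d ->
    `|phi (x + h) - phi x - b * h| <= eta * `|h|.
Proof.
move=> [dphi bE] eta0.
have := dphi; rewrite /derivable => /cvgP; rewrite -/(derive phi x 1) bE.
move=> /cvgrPdist_le /(_ eta eta0) [d /= d0 hd].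
exists d => // h hh; have [->|h0] := eqVneq h 0.
  by rewrite addr0 mulr0 subrr subr0 normr0 mulr0.
have := hd h; rewrite /ball_ /= sub0r normrN => /(_ hh h0).
rewrite /GRing.scale /= mulr1 distrC => hq.
have -> : phi (x + h) - phi x - b * h = (h^-1 * (phi (h + x) - phi x) - b) * h.
  by rewrite mulrBl mulrAC mulVf// mul1r [h + x]addrC.
by rewrite normrM ler_wpM2r.
Qed.

Section GramFieldDefs.
Context {R : realType}.
Local Notation T := (tetra_gram R).

Definition defect (G : 'M[R]_(3, 4)) : 'M[R]_4 := G^T *m G - T.

Definition energy (s : 'M[R]_4) : R := \sum_i \sum_j s i j ^+ 2.

(** The pairing of [dg_i/dt] with [g_j] for a formation with Gram
    matrix [c]. *)
Definition gram_field (phi : R -> R) (c : 'M[R]_4) i j : R :=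
  \sum_(k | k != i) phi (c i k) * (c i k * c i j - c k j).

(** First-order part of [gram_field] at [T + s] for a coupling with value
    [a] and slope [b] at [-1/3]; the order-zero part cancels. *)
Definition gram_field_lin (a b : R) (s : 'M[R]_4) i j : R :=
  \sum_(k | k != i) (b * s i k * (T i k * T i j - T k j)
    + a * (s i k * T i j + T i k * s i j - s k j)).

End GramFieldDefs.

Section GramField.
Context (R : realType).
Local Notation T := (tetra_gram R).

Lemma energy_ge0 (s : 'M[R]_4) : 0 <= energy s.
Proof. by apply: sumr_ge0 => i _; apply: sumr_ge0 => j _; exact: sqr_ge0. Qed.

Lemma le_energy (s : 'M[R]_4) i j : s i j ^+ 2 <= energy s.
Proof.
rewrite /energy (bigD1 i)//= (bigD1 j)//= -addrA lerDl addr_ge0//.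
  by apply: sumr_ge0 => k _; exact: sqr_ge0.
by apply: sumr_ge0 => k _; apply: sumr_ge0 => l _; exact: sqr_ge0.
Qed.

Lemma norm_le_sqrt_energy (s : 'M[R]_4) i j : `|s i j| <= Num.sqrt (energy s).
Proof. by rewrite -sqrtr_sqr ler_wsqrtr// le_energy. Qed.

(** Index the six pairs of agents by the edges of the complete
    graph.  The form is [- (4/9) b D - (4/3) a Q], where [D] is the sum of
    [(s_e - s_e')^2] over the twelve pairs of adjacent edges and [Q] the sum of
    the squared row sums.  As [D + Q = 6 \sum_e s_e^2 = 3 energy s], it suffices
    to bound both coefficients below by [m / 6]. *)
Lemma gram_field_lin_dissipative a b m (s : 'M[R]_4) :
  0 <= m -> m <= 8 * a -> m <= 8 / 3 * b ->
  (forall i, s i i = 0) -> (forall i j, s i j = s j i) ->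
  \sum_i \sum_j s i j * gram_field_lin a b s i j <= - (m / 2) * energy s.
Proof.
move=> m0 ma mb sd ss.
have -> : \sum_i \sum_j s i j * gram_field_lin a b s i j =
  - (4 / 9 * b) * ((s 0 1 - s 0 2%:R) ^+ 2 + (s 0 1 - s 0 3%:R) ^+ 2
    + (s 0 2%:R - s 0 3%:R) ^+ 2 + (s 0 1 - s 1 2%:R) ^+ 2
    + (s 0 1 - s 1 3%:R) ^+ 2 + (s 1 2%:R - s 1 3%:R) ^+ 2
    + (s 0 2%:R - s 1 2%:R) ^+ 2 + (s 0 2%:R - s 2%:R 3%:R) ^+ 2
    + (s 1 2%:R - s 2%:R 3%:R) ^+ 2 + (s 0 3%:R - s 1 3%:R) ^+ 2
    + (s 0 3%:R - s 2%:R 3%:R) ^+ 2 + (s 1 3%:R - s 2%:R 3%:R) ^+ 2)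
  - 4 / 3 * a * ((s 0 1 + s 0 2%:R + s 0 3%:R) ^+ 2
    + (s 0 1 + s 1 2%:R + s 1 3%:R) ^+ 2
    + (s 0 2%:R + s 1 2%:R + s 2%:R 3%:R) ^+ 2
    + (s 0 3%:R + s 1 3%:R + s 2%:R 3%:R) ^+ 2).
  rewrite /gram_field_lin !sum4E !sum4_condE !tetra_gramE /= !sd (ss 1 0) (ss 2%:R 0) (ss 3%:R 0) (ss 2%:R 1).
  rewrite (ss 3%:R 1) (ss 3%:R 2%:R).
  by field.
rewrite /energy !sum4E !sd (ss 1 0) (ss 2%:R 0) (ss 3%:R 0) (ss 2%:R 1).
rewrite (ss 3%:R 1) (ss 3%:R 2%:R).
move: (s 0 1) (s 0 2%:R) (s 0 3%:R) (s 1 2%:R) (s 1 3%:R) (s 2%:R 3%:R).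
move=> s1 s2 s3 s4 s5 s6.
set D := (X in - _ * X - _); set Q := (X in _ - _ * X).
have D0 : 0 <= D by rewrite /D !addr_ge0 ?sqr_ge0.
have Q0 : 0 <= Q by rewrite /Q !addr_ge0 ?sqr_ge0.
rewrite (_ : - (m / 2) * _ = - (m / 6) * D - m / 6 * Q); last first.
  by rewrite /D /Q; field.
rewrite lerB//.
  by rewrite ler_wpM2r// lerN2; lra.
by rewrite ler_wpM2r//; lra.
Qed.

(** Each of the three summands is a product [phi (c_ik) * d] of two
    first-order expansions; the terms left over are quadratic, or carry the
    factor [eta] coming from the coupling. *)
Lemma gram_field_remainder (phi : R -> R) a b eta mu (s : 'M[R]_4) i j :
  0 <= a -> 0 <= b -> 0 <= mu -> mu <= 1 -> 0 <= eta ->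
  (forall k l, `|s k l| <= mu) -> (forall k, s k k = 0) -> i != j ->
  (forall k, k != i -> `|phi (T i k + s i k) - a - b * s i k| <= eta * mu) ->
  `|gram_field phi (T + s) i j - gram_field_lin a b s i j|
    <= 3 * (mu * (a * mu + 3 * b * mu + 4 * eta)).
Proof.
move=> a0 b0 mu0 mu1 eta0 smu sd ij phiE.
have zero : \sum_(k | k != i) a * (T i k * T i j - T k j) = 0.
  rewrite sum4_condE !tetra_gramE.
  by move: i j ij {phiE}; apply: forall4; apply: forall4 => //= _; field.
rewrite -[gram_field_lin _ _ _ _ _]addr0 -zero -big_split /= -sumrB.
apply: le_trans (ler_norm_sum _ _ _) _.
have -> : 3 * (mu * (a * mu + 3 * b * mu + 4 * eta)) =
    \sum_(k | k != i) (mu * (a * mu + 3 * b * mu + 4 * eta)).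
  by rewrite sumr_const cardC1 card_ord /= mulr_natl.
apply: ler_sum => k ki; rewrite ![(T + s) _ _]mxE.
have [e eE] : exists e, phi (T i k + s i k) = a + b * s i k + e.
  by exists (phi (T i k + s i k) - a - b * s i k); ring.
have := phiE k ki; rewrite eE; rewrite (_ : _ - a - _ = e); last by ring.
move=> emu.
have Tb u v : - 1 / 3 <= T u v <= 1.
  by rewrite tetra_gramE; case: eqP => _; apply/andP; split; lra.
have Tij : T i j = - (1 / 3) by rewrite tetra_gramE (negbTE ij).
have Tik : T i k = - (1 / 3) by rewrite tetra_gramE eq_sym (negbTE ki).
set x := s i k; set y := s i j; set z := s k j.
have xm : `|x| <= mu by exact: smu.
have ym : `|y| <= mu by exact: smu.
have zm : `|z| <= mu by exact: smu.
pose d := - (1 / 3) * x - 1 / 3 * y - z + x * y.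
have -> : (a + b * x + e) * ((T i k + x) * (T i j + y) - (T k j + z))
  - (b * x * (T i k * T i j - T k j) + a * (x * T i j + T i k * y - z)
     + a * (T i k * T i j - T k j))
  = a * (x * y) + b * (x * d) + e * (1 / 9 - T k j + d).
  by rewrite Tij Tik /d; field.
have xy : `|x * y| <= mu * mu by rewrite normrM ler_pM.
have dm : `|d| <= 3 * mu.
  have h : mu * mu <= 1 / 3 * mu + 2 / 3 * mu by nra.
  move: xy h xm ym zm; rewrite /d !ler_norml; move: (x * y) (mu * mu) => ? ?.
  by move=> /andP[? ?] ? /andP[? ?] /andP[? ?] /andP[? ?]; apply/andP; split; lra.
have t1 : `|a * (x * y)| <= mu * (a * mu).
  by rewrite normrM (ger0_norm a0) mulrCA ler_wpM2l.
have t2 : `|b * (x * d)| <= mu * (3 * b * mu).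
  rewrite normrM (ger0_norm b0) (_ : mu * _ = b * (mu * (3 * mu))); last by ring.
  by rewrite ler_wpM2l// normrM ler_pM.
have t3 : `|e * (1 / 9 - T k j + d)| <= mu * (4 * eta).
  rewrite normrM (_ : mu * _ = eta * mu * 4); last by ring.
  rewrite ler_pM// ler_norml; move: dm; rewrite ler_norml => /andP[? ?].
  by have /andP[? ?] := Tb k j; apply/andP; split; lra.
rewrite [leRHS]mulrDr [X in _ <= X + _]mulrDr.
apply: le_trans (ler_normD _ _) _; rewrite lerD//.
by apply: le_trans (ler_normD _ _) _; rewrite lerD.
Qed.

Lemma gram_field_lin_bound a b mu (s : 'M[R]_4) i j :
  0 <= a -> 0 <= b -> 0 <= mu -> (forall k l, `|s k l| <= mu) ->
  `|gram_field_lin a b s i j| <= 3 * (mu * (2 * b + 3 * a)).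
Proof.
move=> a0 b0 mu0 smu.
apply: le_trans (ler_norm_sum _ _ _) _.
have -> : 3 * (mu * (2 * b + 3 * a)) = \sum_(k | k != i) (mu * (2 * b + 3 * a)).
  by rewrite sumr_const cardC1 card_ord /= mulr_natl.
have Tb u v : `|T u v| <= 1.
  by rewrite ler_norml tetra_gramE; case: eqP => _; apply/andP; split; lra.
apply: ler_sum => k ki.
have h1 : `|b * s i k * (T i k * T i j - T k j)| <= mu * (2 * b).
  rewrite -mulrA normrM (ger0_norm b0) (_ : mu * _ = b * (mu * 2)); last by ring.
  rewrite ler_wpM2l// normrM ler_pM//.
  apply: le_trans (ler_normB _ _) _; rewrite -[2]/(1 + 1) lerD//.
  by rewrite normrM mulr_ile1.
have h2 : `|a * (s i k * T i j + T i k * s i j - s k j)| <= mu * (3 * a).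
  rewrite normrM (ger0_norm a0) (_ : mu * _ = a * (mu + mu + mu)); last by ring.
  rewrite ler_wpM2l//; apply: le_trans (ler_normB _ _) _; rewrite lerD//.
  apply: le_trans (ler_normD _ _) _; rewrite !normrM lerD//.
    by rewrite -[leRHS]mulr1 ler_pM.
  by rewrite -[leRHS]mul1r ler_pM.
by rewrite [leRHS]mulrDr; apply: le_trans (ler_normD _ _) _; rewrite lerD.
Qed.

End GramField.

(** * Gronwall estimates and the energy along a curve *)

(** The function [h (t) exp (c (a - t))] is nonincreasing. *)
Lemma gronwall_decay (R : realType) (h dh : R -> R) (a b c : R) :
  a <= b -> {within `[a, b], continuous h} ->
  (forall t, t \in `]a, b[ -> is_derive t 1 h (dh t)) ->
  (forall t, t \in `]a, b[ -> dh t <= c * h t) ->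
  h b <= h a * expR (c * (b - a)).
Proof.
move=> ab hc hd dhc.
pose E (t : R) := expR (c * (a - t)).
have dE (t : R) : is_derive t 1 E (- c * E t).
  have d1 : is_derive t 1 (fun s : R => c * (a - s)) (- c).
    have := is_deriveM (is_derive_cst c t 1) (is_deriveB (is_derive_cst a t 1) (is_derive_id t (1 : R))).
    move=> d; refine (is_derive_eq d _).
    by rewrite /= scaler0 addr0 sub0r /GRing.scale /= mulrN1.
  refine (is_derive_eq (is_derive1_comp (is_derive_expR _) d1) _).
  by rewrite mulrC.
pose g t := h t * E t.
have dg t : t \in `]a, b[ -> is_derive t 1 g (E t * (dh t - c * h t)).
  move=> tab; refine (is_derive_eq (is_deriveM (hd t tab) (dE t)) _).
  by rewrite /GRing.scale /=; ring.
have gE : g b <= g a.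
  apply: (@ler0_derive1_le_cc R g a b) => //.
  - by move=> t tab; have [] := dg t tab.
  - move=> t tab; rewrite derive1E (@derive_val _ _ _ _ _ _ _ (dg t tab)).
    by rewrite pmulr_rle0 ?expR_gt0// subr_le0 dhc.
  - move=> t; apply: (@continuousM _ (subspace `[a, b])); first exact: hc.
    apply: continuous_subspaceT => {}t; apply: differentiable_continuous.
    by apply/derivable1_diffP; have [] := dE t.
  - by rewrite in_itv /= ab lexx.
  - by rewrite in_itv /= ab lexx.
move: gE; rewrite /g /E subrr mulr0 expR0 mulr1 => gE.
rewrite -[h b]mulr1 -expR0 (_ : 0 = c * (a - b) + c * (b - a)); last by ring.
by rewrite expRD mulrA ler_wpM2r// expR_ge0.
Qed.

(** The differential inequality is only available where [h < e].  At the
    first time [tau] with [h >= e], Gronwall's inequality on [[a, tau]] gives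
    [h tau < e], which continuity contradicts. *)
Lemma local_gronwall (R : realType) (h dh : R -> R) (a b c e : R) :
  a <= b -> {within `[a, b], continuous h} ->
  (forall t, t \in `]a, b[ -> is_derive t 1 h (dh t)) ->
  (forall t, t \in `]a, b[ -> h t < e -> dh t <= c * h t) ->
  (forall t, t \in `[a, b] -> h a * expR (c * (t - a)) < e) ->
  h b <= h a * expR (c * (b - a)).
Proof.
move=> ab hc hd dhc hE.
have pre tau : tau \in `[a, b] -> (forall t, t \in `[a, tau[ -> h t < e) ->
    h tau <= h a * expR (c * (tau - a)).
  rewrite in_itv /= => /andP[at_ tb] small.
  have sub : `]a, tau[ `<=` `]a, b[ by apply: subset_itvl; rewrite bnd_simp.
  apply: (gronwall_decay _ _ dh) => //.
  - by apply: continuous_subspaceW hc; apply: subset_itvl; rewrite bnd_simp.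
  - by move=> t /sub; exact: hd.
  - move=> t tat; apply: dhc; first exact: sub.
    by apply: small; move: tat; rewrite !in_itv /= => /andP[/ltW -> ->].
apply: (pre b); first by rewrite in_itv /= ab lexx.
suff small : forall t, t \in `[a, b] -> h t < e.
  move=> t; rewrite in_itv /= => /andP[at_ tb]; apply: small.
  by rewrite in_itv /= at_ ltW.
move=> t1 t1ab; rewrite ltNge; apply/negP => ht1.
pose A := [set t | t \in `[a, b] /\ e <= h t].
have A1 : A t1 by [].
have lbA : lbound A a by move=> t [] /itvP ->.
have hA : has_inf A by split; [exists t1 | exists a].
pose tau := inf A.
have tauab : tau \in `[a, b].
  rewrite in_itv /= lb_le_inf//=; last by exists t1.
  apply: (@le_trans _ _ t1); last by rewrite (itvP t1ab).
  by apply: ge_inf => //; exists a.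
have before t : t \in `[a, tau[ -> h t < e.
  move=> tt; rewrite ltNge; apply/negP => het.
  have : tau <= t.
    apply: ge_inf; first by exists a.
    split=> //; rewrite in_itv /= (itvP tt) /=.
    by apply: (@le_trans _ _ tau); rewrite ?(itvP tauab)// (itvP tt).
  by rewrite leNgt (itvP tt).
have htau : h tau < e by apply: le_lt_trans (hE _ tauab); exact: pre.
have /subspace_continuousP/(_ tau tauab) := hc.
move=> /cvgrPdist_lt /(_ (e - h tau)); rewrite subr_gt0 => /(_ htau).
move=> [d /= d0 hdd].
have [t [tab het] ttau] := inf_adherent d0 hA.
have tt : tau <= t by apply: ge_inf; [exists a | split].
have := hdd t; rewrite /ball_ /= => /(_ _ tab).
rewrite distrC ger0_norm ?subr_ge0// ltrBlDl ttau => /(_ isT).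
rewrite ltr_distlC => /andP[_]; rewrite addrC subrK => /(le_lt_trans het).
by rewrite ltxx.
Qed.

Section Energy.
Context (R : realType).

Lemma is_derive_energy (gamma : R -> 'M[R]_(3, 4)) (t : R) (v : 'M[R]_(3, 4)) :
  is_derive t 1 gamma v ->
  is_derive t 1 (fun s => energy (defect (gamma s)))
    (\sum_i \sum_j 2 * (defect (gamma t) i j * polar_gram (gamma t) v i j)).
Proof.
move=> dg; rewrite /energy; apply: is_derive_bigsum => i _.
apply: is_derive_bigsum => j _.
have dd : is_derive t 1 (fun s => defect (gamma s) i j)
    (polar_gram (gamma t) v i j).
  under eq_fun => s do rewrite mxE.
  have d1 := is_derive_gram_curve R 3 4 gamma t v i j dg.
  have d2 := is_derive_cst ((- tetra_gram R : 'M[R]_4) i j) t (1 : R).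
  by refine (is_derive_eq (is_deriveD d1 d2) _); rewrite addr0.
under eq_fun => s do rewrite expr2.
refine (is_derive_eq (is_deriveM dd dd) _).
by rewrite /GRing.scale /=; ring.
Qed.

Lemma continuous_energy : continuous (fun G : 'M[R]_(3, 4) => energy (defect G)).
Proof.
move=> G; apply: differentiable_continuous.
apply: differentiable_bigsum => i _; apply: differentiable_bigsum => j _.
under eq_fun => s do rewrite expr2.
have dd : differentiable (fun s : 'M[R]_(3, 4) => defect s i j) G.
  under eq_fun => s do rewrite mxE.
  by apply: differentiableD; [exact: differentiable_gram | exact: differentiable_cst].
exact: (differentiableM dd dd).
Qed.

Lemma energy_eq0 (G : 'M[R]_(3, 4)) :
  (energy (defect G) <= 0) <-> Omega_T G.
Proof.
rewrite Omega_TP; split=> [h|GG].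
  apply/eqP; rewrite -subr_eq0; apply/eqP/matrixP => i j; rewrite [RHS]mxE.
  apply/eqP; rewrite -sqrf_eq0 eq_le sqr_ge0 andbT.
  exact: le_trans (le_energy _ _ _ _) h.
rewrite /energy big1// => i _; rewrite big1// => j _.
by rewrite /defect GG subrr mxE expr0n.
Qed.

End Energy.

(** * The energy inequality near the tetrahedra *)

(** Derivative of the energy along the closed loop. *)
Definition energy_rate {R : realType} (f : R -> R) (G : 'M[R]_(3, 4)) : R :=
  \sum_i \sum_j 2 * (defect G i j *
    polar_gram G (closed_loop complete_graph f G) i j).

Lemma defect_sym (R : realType) (G : 'M[R]_(3, 4)) i j :
  defect G i j = defect G j i.
Proof.
by rewrite /defect mxE [RHS]mxE trmx_mulC; congr (_ + _); rewrite !mxE eq_sym.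
Qed.

Lemma energy_rateE (R : realType) (f : R -> R) (G : 'M[R]_(3, 4)) :
  formations G -> energy_rate f G =
  4 * \sum_i \sum_j defect G i j * gram_field (f \o acos) (G^T *m G) i j.
Proof.
move=> /formationsP G1.
pose q i j := gram_field (f \o acos) (G^T *m G) i j.
have pE i j : polar_gram G (closed_loop complete_graph f G) i j = q i j + q j i.
  rewrite mxE [X in _ + X]trmx_mulC; congr (_ + _); rewrite closed_loop_dot;
    by apply: eq_bigr => k _; rewrite G1 mul1r.
rewrite /energy_rate -/q.
under eq_bigr => i _ do under eq_bigr => j _ do rewrite pE !mulrDr.
under eq_bigr => i _ do rewrite big_split.
rewrite big_split /= [X in _ + X]exchange_big /=.
under [X in _ + X]eq_bigr => i _ do under eq_bigr => j _ do rewrite defect_sym.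
rewrite -big_split /= mulr_sumr; apply: eq_bigr => i _.
rewrite -big_split /= mulr_sumr; apply: eq_bigr => j _.
by rewrite -/(q i j); ring.
Qed.

(** The energy bounds the square of every entry of the defect, so with
    [mu = sqrt V] the linear part contributes at most [- 2 m V] and the
    remainder at most [192 (a mu + 3 b mu + 4 eta) V <= m V] once [mu] and
    [eta] are small (192 = 4 * 16 * 3: the prefactor, the entries and the
    summands of each entry). *)
Lemma energy_rate_bounds (R : realType) (f : R -> R) (b : R) :
  0 < f (acos (- (1 / 3))) -> 0 < b ->
  is_derive (- (1 / 3) : R) 1 (f \o acos) b ->
  exists m C e : R, [/\ 0 < m, 0 < C, 0 < e &
    forall G, formations G -> energy (defect G) < e ->
      - C * energy (defect G) <= energy_rate f G <=
      - m * energy (defect G)].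
Proof.
set a := f _ => a0 b0 db.
pose m := Num.min (8 * a) (8 / 3 * b).
have m0 : 0 < m by rewrite /m lt_min; apply/andP; split; lra.
have [ma mb] : m <= 8 * a /\ m <= 8 / 3 * b.
  by rewrite /m !ge_min !lexx orbT.
(* Chosen so that [192 * 4 * eta] and [192 * (a + 3 * b) * mu0] are at most
   [m / 2]. *)
pose eta := m / (192 * 8).
have eta0 : 0 < eta by rewrite /eta; lra.
have [d d0 hd] := derive_approx R (f \o acos) _ _ _ db eta0.
pose mu0 := Num.min (Num.min 1 d) (m / (192 * 2 * (a + 3 * b))).
have ab0 : 0 < a + 3 * b by lra.
have mu00 : 0 < mu0.
  by rewrite !lt_min ltr01 d0 /= divr_gt0// mulr_gt0.
have [mu1 mud mum] : [/\ mu0 <= 1, mu0 <= d & mu0 * (192 * 2 * (a + 3 * b)) <= m].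
  split; first by rewrite !ge_min lexx.
    by rewrite !ge_min lexx orbT.
  by rewrite -ler_pdivlMr ?mulr_gt0// /mu0 ge_min lexx orbT.
(* The first summand of [C] bounds the linear part, the second the remainder. *)
exists m, (4 * 16 * (3 * (2 * b + 3 * a)) + m), (mu0 ^+ 2); split => //.
- by rewrite addr_gt0// !mulr_gt0//; lra.
- by rewrite exprn_gt0.
move=> G FG; set V := energy _ => Ve.
have V0 : 0 <= V by exact: energy_ge0.
pose mu := Num.sqrt V.
have muV : mu * mu = V by rewrite -expr2 sqr_sqrtr.
have mu_ge0 : 0 <= mu by exact: sqrtr_ge0.
have mulm : mu < mu0.
  by rewrite -(ger0_norm (ltW mu00)) -sqrtr_sqr ltr_sqrt// exprn_gt0.
have smu := norm_le_sqrt_energy R (defect G).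
pose s := defect G.
have G1 := (formationsP _ _).1 FG.
have sd i : s i i = 0 by rewrite /s /defect mxE G1 !mxE eqxx /=; field.
have ss i j : s i j = s j i by exact: defect_sym.
have Ts : tetra_gram R + s = G^T *m G by rewrite /s /defect addrC subrK.
have rem i j : `|s i j * gram_field (f \o acos) (G^T *m G) i j
    - s i j * gram_field_lin a b s i j| <= mu * (3 * (mu * (m / 192))).
  rewrite -mulrBr normrM.
  have [->|ij] := eqVneq i j.
    rewrite sd normr0 mul0r !mulr_ge0//.
    exact: ltW.
  apply: ler_pM => //.
  rewrite -Ts.
  apply: (le_trans (gram_field_remainder R _ _ _ eta mu _ _ _ _ _ _ _ _ _ _ ij _));
    rewrite ?(ltW a0) ?(ltW b0) ?(ltW eta0) ?sd//.
  - by apply: le_trans mu1; exact: ltW.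
  - move=> k ki.
    have Tik : tetra_gram R i k = - (1 / 3) by rewrite tetra_gramE eq_sym (negbTE ki).
    rewrite Tik; have sk := smu i k.
    apply: le_trans (hd _ _) _.
      by apply: le_lt_trans sk _; exact: lt_le_trans mud.
    by rewrite ler_wpM2l// ltW.
  - rewrite ler_wpM2l// ler_wpM2l// /eta.
    have : mu * (a + 3 * b) <= mu0 * (a + 3 * b) by rewrite ler_wpM2r// ltW.
    by lra.
have linB i j : `|s i j * gram_field_lin a b s i j| <=
    mu * (3 * (mu * (2 * b + 3 * a))).
  rewrite normrM; apply: ler_pM => //.
  by apply: gram_field_lin_bound => //; exact: ltW.
have lin_sum := gram_field_lin_dissipative R a b m s (ltW m0) ma mb sd ss.
set L := (X in X <= _) in lin_sum.
pose Q := \sum_i \sum_j s i j * gram_field (f \o acos) (G^T *m G) i j.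
have sum2_le (F : 'I_4 -> 'I_4 -> R) B : (forall i j, `|F i j| <= B) ->
    `|\sum_i \sum_j F i j| <= 16 * B.
  move=> FB; apply: le_trans (ler_norm_sum _ _ _) _.
  apply: le_trans (_ : \sum_(i < 4) (4 * B) <= _).
    apply: ler_sum => i _; apply: le_trans (ler_norm_sum _ _ _) _.
    apply: le_trans (_ : \sum_(i < 4) B <= _); first exact: ler_sum.
    by rewrite sumr_const card_ord mulr_natl.
  by rewrite sumr_const card_ord -mulr_natl; lra.
have QL : `|Q - L| <= 16 * (mu * (3 * (mu * (m / 192)))).
  rewrite -sumrB; under eq_bigr => i _ do rewrite -sumrB.
  exact: sum2_le.
have LB : `|L| <= 16 * (mu * (3 * (mu * (2 * b + 3 * a)))) by exact: sum2_le.
rewrite energy_rateE// -/s -/Q.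
have e1 x : mu * (3 * (mu * x)) = 3 * (V * x) by rewrite -muV; ring.
rewrite !e1 in QL LB.
have sV : energy s = V by [].
rewrite sV in lin_sum.
move: QL LB; rewrite !ler_norml => /andP[q1 q2] /andP[l1 l2].
by apply/andP; split; lra.
Qed.

(** * The distance to the tetrahedra *)

(** Complete [x], [y] by their cross product; its sign is chosen to make
    the last coordinate of [w] nonnegative. *)
Lemma orthonormal_frame (R : realType) (x y w : 'cV[R]_3) :
  dotmul x x = 1 -> dotmul y y = 1 -> dotmul x y = 0 ->
  exists E : 'M[R]_3, [/\ E *m E^T = 1%:M, E *m x = delta_mx 0 0,
    E *m y = delta_mx 1 0 & 0 <= (E *m w) 2%:R 0].
Proof.
rewrite !dotmulE => xx yy xy.
have [z z0 z1] : exists2 z : 'cV[R]_3, z 0 0 = x 1 0 * y 2%:R 0 - x 2%:R 0 * y 1 0 &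
    z 1 0 = x 2%:R 0 * y 0 0 - x 0 0 * y 2%:R 0 /\
    z 2%:R 0 = x 0 0 * y 1 0 - x 1 0 * y 0 0.
  by exists (hat x *m y); rewrite hat_mulE !mxE.
case: z1 => z1 z2.
have [sg [sg1 zw]] : exists sg : R, sg * sg = 1 /\ 0 <= sg * dotmul z w.
  have [h|h] := leP 0 (dotmul z w); first by exists 1; rewrite !mul1r.
  by exists (- 1); rewrite mulrNN mulN1r mul1r oppr_ge0 ltW.
pose E : 'M[R]_3 := \matrix_(i, j) nth 0 [:: x j 0; y j 0; sg * z j 0] i.
exists E; split.
- apply/matrixP => i j; rewrite mxE sum3E !mxE ?z0 ?z1 ?z2 /=.
  move: z0 z1 z2 xx yy xy; move: (x 0 0) (x 1 0) (x 2%:R 0) (y 0 0) (y 1 0) (y 2%:R 0).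
  move=> x0 x1 x2 y0 y1 y2 z0 z1 z2 xx yy xy.
  have zz : (x1 * y2 - x2 * y1) ^+ 2 + (x2 * y0 - x0 * y2) ^+ 2
      + (x0 * y1 - x1 * y0) ^+ 2 = 1.
    rewrite (_ : _ + _ = (x0 * x0 + x1 * x1 + x2 * x2) * (y0 * y0 + y1 * y1 + y2 * y2)
      - (x0 * y0 + x1 * y1 + x2 * y2) ^+ 2); last by ring.
    by rewrite xx yy xy; ring.
  move: i j; apply: forall3; apply: forall3; rewrite /= ?mulr0n ?mulr1n.
  + exact: xx.
  + exact: xy.
  + by ring.
  + by rewrite -[RHS]xy; ring.
  + exact: yy.
  + by ring.
  + by ring.
  + by ring.
  + by rewrite -[RHS]sg1 -[RHS]mulr1 -[in RHS]zz; ring.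
- apply/matrixP => i j; rewrite ord1 mxE sum3E !mxE ?z0 ?z1 ?z2 /=.
  move: i; apply: forall3; rewrite /= ?mulr0n ?mulr1n.
  + exact: xx.
  + by rewrite -[RHS]xy; ring.
  + by ring.
- apply/matrixP => i j; rewrite ord1 mxE sum3E !mxE ?z0 ?z1 ?z2 /=.
  move: i; apply: forall3; rewrite /= ?mulr0n ?mulr1n.
  + exact: xy.
  + exact: yy.
  + by ring.
- move: zw; rewrite dotmulE mxE sum3E !mxE /=; congr (_ <= _).
  by ring.
Qed.

Lemma norm_le_of_mul (R : realType) (r rho u k : R) :
  0 < rho -> rho <= r -> `|r * u| <= rho * k -> `|u| <= k.
Proof.
move=> rho0 rr; rewrite normrM (ger0_norm (le_trans (ltW rho0) rr)) => h.
rewrite -(ler_pM2l rho0); apply: le_trans h.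
by rewrite ler_wpM2r.
Qed.

Definition tetra_y (R : realType) : R := Num.sqrt (8 / 9).
Definition tetra_z (R : realType) : R := Num.sqrt (2 / 3).

(** The regular tetrahedron in triangular position. *)
Definition tetrahedron (R : realType) : 'M[R]_(3, 4) :=
  \matrix_(i, j) nth 0 (nth [::]
    [:: [:: 1; - (1 / 3); - (1 / 3); - (1 / 3)];
        [:: 0; tetra_y R; - (tetra_y R / 2); - (tetra_y R / 2)];
        [:: 0; 0; tetra_z R; - tetra_z R]] i) j.

Lemma tetra_y_sqr (R : realType) : tetra_y R * tetra_y R = 8 / 9.
Proof. by rewrite -expr2 sqr_sqrtr//; lra. Qed.

Lemma tetra_z_sqr (R : realType) : tetra_z R * tetra_z R = 2 / 3.
Proof. by rewrite -expr2 sqr_sqrtr//; lra. Qed.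

Lemma tetrahedron_gram (R : realType) :
  (tetrahedron R)^T *m tetrahedron R = tetra_gram R.
Proof.
have yy := tetra_y_sqr R; have zz := tetra_z_sqr R.
apply/matrixP => i j; rewrite mxE sum3E !mxE.
move: i j; apply: forall4; apply: forall4; rewrite /=; lra.
Qed.

(** [r], [x], [y], [w], [z] are the entries below the first row of a
    triangular matrix whose Gram matrix is [T + s].  Each is obtained from the
    preceding ones by dividing by a pivot [r] or [y], or by a sum
    [r + tetra_y], [y + tetra_z], all bounded away from zero, so the error
    stays proportional to [mu]. *)
Lemma triangular_close (R : realType) (mu s01 s02 s03 s12 s13 s23 : R)
    (r x w y z : R) :
  mu <= 1 / 100 ->
  `|s01| <= mu -> `|s02| <= mu -> `|s03| <= mu ->
  `|s12| <= mu -> `|s13| <= mu -> `|s23| <= mu ->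
  0 <= r -> 0 <= y ->
  (- (1 / 3) + s01) ^+ 2 + r ^+ 2 = 1 ->
  (- (1 / 3) + s01) * (- (1 / 3) + s02) + r * x = - (1 / 3) + s12 ->
  (- (1 / 3) + s01) * (- (1 / 3) + s03) + r * w = - (1 / 3) + s13 ->
  (- (1 / 3) + s02) ^+ 2 + x ^+ 2 + y ^+ 2 = 1 ->
  (- (1 / 3) + s02) * (- (1 / 3) + s03) + x * w + y * z = - (1 / 3) + s23 ->
  [/\ `|r - tetra_y R| <= mu, `|x + tetra_y R / 2| <= 3 * mu,
      `|w + tetra_y R / 2| <= 3 * mu, `|y - tetra_z R| <= 5 * mu &
      `|z + tetra_z R| <= 12 * mu].
Proof.
move=> mu1 b01 b02 b03 b12 b13 b23 r0 y0 e11 e12 e13 e22 e23.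
have mu0 : 0 <= mu by exact: (le_trans (normr_ge0 s01) b01).
have kk := tetra_y_sqr R; have nn := tetra_z_sqr R.
have k0 : 0 <= tetra_y R by exact: sqrtr_ge0.
have n0 : 0 <= tetra_z R by exact: sqrtr_ge0.
move: (tetra_y R) (tetra_z R) kk nn k0 n0 => k n kk nn k0 n0.
(* Numerically [k] is 0.943 and [n] is 0.816. *)
have [k1 k2] : 94 / 100 <= k /\ k <= 95 / 100 by split; nra.
have [n1 n2] : 81 / 100 <= n /\ n <= 82 / 100 by split; nra.
have prod u v : `|u| <= mu -> `|v| <= mu -> `|u * v| <= mu / 100.
  move=> hu hv; rewrite normrM (_ : mu / 100 = mu * (1 / 100)); last by field.
  by rewrite ler_pM//; apply: le_trans mu1.
have rk : `|r - k| <= mu.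
  apply: (norm_le_of_mul _ (r + k) (94 / 100)); [lra|lra|].
  rewrite (_ : (r + k) * (r - k) = 2 / 3 * s01 - s01 * s01); last by lra.
  move: (prod _ _ b01 b01) (b01); rewrite !ler_norml; clear -mu0.
  move=> /andP[? ?] /andP[? ?]; by apply/andP; split; lra.
have r1 : 93 / 100 <= r by move: rk; rewrite ler_norml => /andP[? ?]; lra.
have mid t s3 s4 : `|s3| <= mu -> `|s4| <= mu ->
    (- (1 / 3) + s01) * (- (1 / 3) + s3) + r * t = - (1 / 3) + s4 ->
    `|t + k / 2| <= 3 * mu.
  move=> h3 h4 e.
  apply: (norm_le_of_mul _ r (93 / 100)) => //.
  have -> : r * (t + k / 2) = s4 + (s01 + s3) / 3 - s01 * s3 + k / 2 * (r - k).
    by lra.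
  have kr : `|k / 2 * (r - k)| <= 1 / 2 * mu.
    by rewrite normrM ler_pM// ger0_norm; lra.
  move: (prod _ _ b01 h3) (b01) (h3) h4 kr; rewrite !ler_norml; clear -mu0.
  move=> /andP[? ?] /andP[? ?] /andP[? ?] /andP[? ?] /andP[? ?].
  by apply/andP; split; lra.
have xk := mid x s02 s12 b02 b12 e12.
have wk := mid w s03 s13 b03 b13 e13.
have small u v : `|u| <= 3 * mu -> `|v| <= 3 * mu -> `|u * v| <= 9 / 100 * mu.
  move=> hu hv; rewrite normrM (_ : 9 / 100 * mu = 3 * mu * (3 / 100)); last by field.
  by rewrite ler_pM//; apply: le_trans hv _; lra.
have yn : `|y - n| <= 5 * mu.
  apply: (norm_le_of_mul _ (y + n) (81 / 100)); [lra|lra|].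
  have -> : (y + n) * (y - n) = 2 / 3 * s02 - s02 * s02
      + k * (x + k / 2) - (x + k / 2) * (x + k / 2) by lra.
  have kx : `|k * (x + k / 2)| <= 95 / 100 * (3 * mu).
    by rewrite normrM ler_pM// ger0_norm.
  move: (prod _ _ b02 b02) (small _ _ xk xk) (b02) kx; rewrite !ler_norml; clear -mu0.
  move=> /andP[? ?] /andP[? ?] /andP[? ?] /andP[? ?].
  by apply/andP; split; lra.
split=> //.
apply: (norm_le_of_mul _ y (75 / 100)); first by lra.
  by move: yn; rewrite ler_norml => /andP[? ?]; lra.
have -> : y * (z + n) = s23 + (s02 + s03) / 3 - s02 * s03
    - (x + k / 2) * (w + k / 2) + k / 2 * (x + k / 2) + k / 2 * (w + k / 2)
    + n * (y - n) by lra.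
have kx u : `|u| <= 3 * mu -> `|k / 2 * u| <= 48 / 100 * (3 * mu).
  by move=> hu; rewrite normrM ler_pM// ger0_norm; lra.
have ny : `|n * (y - n)| <= 82 / 100 * (5 * mu).
  by rewrite normrM ler_pM// ger0_norm.
move: (prod _ _ b02 b03) (small _ _ xk wk) b23 (b02) (b03) (kx _ xk) (kx _ wk) ny.
rewrite !ler_norml; clear -mu0.
move=> /andP[? ?] /andP[? ?] /andP[? ?] /andP[? ?] /andP[? ?] /andP[? ?] /andP[? ?] /andP[? ?].
by apply/andP; split; lra.
Qed.

Lemma mx_entry_le_norm (R : realType) m n (M : 'M[R]_(m, n)) i j :
  `|M i j| <= `|M|.
Proof. by rewrite [leRHS]mx_normrE (le_bigmax _ _ (i, j)). Qed.

Lemma mx_norm_le (R : realType) m n (M : 'M[R]_(m, n)) e : 0 <= e ->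
  (forall i j, `|M i j| <= e) -> `|M| <= e.
Proof. by move=> e0 h; rewrite [leLHS]mx_normrE bigmax_le. Qed.

Lemma tetrahedron_Omega_T (R : realType) : Omega_T (tetrahedron R).
Proof. exact/Omega_TP/tetrahedron_gram. Qed.

Lemma formation_entry (R : realType) (G : 'M[R]_(3, 4)) k i :
  formations G -> `|G k i| <= 1.
Proof.
move=> /formationsP/(_ i); rewrite mxE => G1.
rewrite -(@ler_pXn2r _ 2)// ?nnegrE// expr1n -normrX ger0_norm ?sqr_ge0//.
rewrite -G1 (bigD1 k)//= mxE -expr2 lerDl.
by apply: sumr_ge0 => l _; rewrite mxE -expr2 sqr_ge0.
Qed.

(** The entries of a formation are bounded by one, so the Gram matrix is a
    Lipschitz function of the formation. *)
Lemma sqrt_energy_le_dist (R : realType) (G P : 'M[R]_(3, 4)) :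
  formations G -> Omega_T P ->
  Num.sqrt (energy (defect G)) <= 24 * `|G - P|.
Proof.
move=> FG OP; have FP : formations P by case: OP.
have /Omega_TP PP := OP.
have sB i j : `|defect G i j| <= 6 * `|G - P|.
  have -> : defect G i j = \sum_k (G k i * (G - P) k j + (G - P) k i * P k j).
    rewrite /defect -PP !mxE -sumrB; apply: eq_bigr => k _; rewrite !mxE.
    by ring.
  apply: le_trans (ler_norm_sum _ _ _) _.
  apply: le_trans (_ : \sum_(k < 3) (2 * `|G - P|) <= _); last first.
    by rewrite sumr_const card_ord -[leLHS]mulr_natl; lra.
  apply: ler_sum => k _; apply: le_trans (ler_normD _ _) _.
  rewrite (_ : 2 * _ = 1 * `|G - P| + `|G - P| * 1); last by ring.
  by rewrite !normrM lerD// ler_pM// ?formation_entry ?mx_entry_le_norm.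
have h : energy (defect G) <= (24 * `|G - P|) ^+ 2.
  rewrite /energy.
  apply: le_trans (_ : \sum_(i < 4) \sum_(j < 4) (6 * `|G - P|) ^+ 2 <= _).
    apply: ler_sum => i _; apply: ler_sum => j _.
    rewrite -[X in X <= _]ger0_norm ?sqr_ge0// normrX.
    by rewrite ler_pXn2r// nnegrE mulr_ge0.
  by rewrite !sumr_const !card_ord -mulrnA -[leLHS]mulr_natl; lra.
rewrite -[leRHS]ger0_norm ?mulr_ge0// -sqrtr_sqr.
exact: ler_wsqrtr.
Qed.

(** Gram-Schmidt on the first two agents gives an orthogonal [E] with
    [E G] triangular; the tetrahedron is the standard one moved back by
    [E^T]. *)
Lemma close_tetrahedron (R : realType) (G : 'M[R]_(3, 4)) :
  formations G -> Num.sqrt (energy (defect G)) <= 1 / 100 ->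
  exists2 P, Omega_T P &
    `|G - P| <= 36 * Num.sqrt (energy (defect G)).
Proof.
move=> FG; set mu := Num.sqrt _ => mu1.
have smu i j : `|defect G i j| <= mu by exact: norm_le_sqrt_energy.
have mu0 : 0 <= mu by exact: sqrtr_ge0.
have G1 := (formationsP _ _).1 FG.
pose s := defect G.
have gE i j : i != j -> (G^T *m G) i j = - (1 / 3) + s i j.
  move=> ij; have -> : s i j = (G^T *m G) i j - tetra_gram R i j.
    by rewrite /s /defect mxE [X in _ + X]mxE.
  by rewrite tetra_gramE (negbTE ij); ring.
pose c := (G^T *m G) 0 1.
have cE : c = - (1 / 3) + s 0 1 by exact: gE.
have c1 : 0 < 1 - c ^+ 2.
  have := smu 0 1; rewrite -/s cE ler_norml => /andP[? ?].
  by nra.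
pose r := Num.sqrt (1 - c ^+ 2).
have r0 : 0 < r by rewrite sqrtr_gt0.
have rr : r ^+ 2 = 1 - c ^+ 2 by rewrite sqr_sqrtr// ltW.
pose x := col 0 G.
pose y : 'cV_3 := r^-1 *: (col 1 G - c *: x).
have xx : dotmul x x = 1 by rewrite dotmul_col G1.
have d01 : dotmul x (col 1 G) = c by rewrite dotmul_col.
have d11 : dotmul (col 1 G) (col 1 G) = 1 by rewrite dotmul_col G1.
have xy : dotmul x y = 0.
  move: xx d01; rewrite !dotmulE /y !mxE => xx d01.
  rewrite (_ : _ + _ = r^-1 * (c - c * 1)); last by rewrite -[in RHS]xx -[in LHS]d01 -d01; ring.
  by rewrite mulr1 subrr mulr0.
have yy : dotmul y y = 1.
  have -> : dotmul y y = r^-1 ^+ 2 * (dotmul (col 1 G) (col 1 G)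
      - 2 * c * dotmul x (col 1 G) + c ^+ 2 * dotmul x x).
    by rewrite !dotmulE /y !mxE; ring.
  rewrite d11 d01 xx (_ : 1 - _ + _ = r ^+ 2); last by rewrite rr; ring.
  by rewrite -exprMn mulVf ?gt_eqF// expr1n.
have [E [EE Ex Ey Ew]] := orthonormal_frame R x y (col 2%:R G) xx yy xy.
have EtE : E^T *m E = 1%:M by exact: mulmx1C.
pose Y := E *m G.
have YY : Y^T *m Y = G^T *m G.
  by rewrite trmx_mul mulmxA -(mulmxA G^T) EtE mulmx1.
have colY i : col i Y = E *m col i G by rewrite !colE mulmxA.
have Y0 : col 0 Y = delta_mx 0 0 by rewrite colY; exact: Ex.
have Y1 : col 1 Y = c *: delta_mx 0 0 + r *: delta_mx 1 0.
  rewrite colY (_ : col 1 G = c *: x + r *: y).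
    by rewrite mulmxDr -(scalemxAr c) Ex -(scalemxAr r) Ey.
  by rewrite /y scalerA divff ?gt_eqF// scale1r addrC subrK.
have colYE i k : Y k i = col i Y k 0 by rewrite [RHS]mxE.
have Y00 : Y 0 0 = 1 by rewrite colYE Y0 mxE.
have Y10 : Y 1 0 = 0 by rewrite colYE Y0 mxE.
have Y20 : Y 2%:R 0 = 0 by rewrite colYE Y0 mxE.
have Y01 : Y 0 1 = c by rewrite colYE Y1 !mxE /=; ring.
have Y11 : Y 1 1 = r by rewrite colYE Y1 !mxE /=; ring.
have Y21 : Y 2%:R 1 = 0 by rewrite colYE Y1 !mxE /=; ring.
have Y22 : 0 <= Y 2%:R 2%:R by rewrite colYE colY.
have gY i j : (G^T *m G) i j =
    Y 0 i * Y 0 j + Y 1 i * Y 1 j + Y 2%:R i * Y 2%:R j.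
  by rewrite -YY mxE sum3E !mxE.
have Y02 : Y 0 2%:R = - (1 / 3) + s 0 2%:R.
  by rewrite -gE// gY Y00 Y10 Y20; ring.
have Y03 : Y 0 3%:R = - (1 / 3) + s 0 3%:R.
  by rewrite -gE// gY Y00 Y10 Y20; ring.
have e11 : (- (1 / 3) + s 0 1) ^+ 2 + r ^+ 2 = 1 by rewrite rr cE; ring.
have e12 : (- (1 / 3) + s 0 1) * (- (1 / 3) + s 0 2%:R) + r * Y 1 2%:R =
    - (1 / 3) + s 1 2%:R.
  by rewrite -(gE 1)// gY Y01 Y11 Y21 Y02 cE; ring.
have e13 : (- (1 / 3) + s 0 1) * (- (1 / 3) + s 0 3%:R) + r * Y 1 3%:R =
    - (1 / 3) + s 1 3%:R.
  by rewrite -(gE 1)// gY Y01 Y11 Y21 Y03 cE; ring.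
have e22 : (- (1 / 3) + s 0 2%:R) ^+ 2 + Y 1 2%:R ^+ 2 + Y 2%:R 2%:R ^+ 2 = 1.
  by rewrite -[RHS](G1 2%:R) gY Y02; ring.
have e23 : (- (1 / 3) + s 0 2%:R) * (- (1 / 3) + s 0 3%:R) + Y 1 2%:R * Y 1 3%:R
    + Y 2%:R 2%:R * Y 2%:R 3%:R = - (1 / 3) + s 2%:R 3%:R.
  by rewrite -(gE 2%:R)// gY Y02 Y03.
have [b1 b2 b3 b4 b5] := triangular_close R mu _ _ _ _ _ _ _ _ _ _ _ mu1 (smu 0 1)
  (smu 0 2%:R) (smu 0 3%:R) (smu 1 2%:R) (smu 1 3%:R) (smu 2%:R 3%:R)
  (ltW r0) Y22 e11 e12 e13 e22 e23.
have YT i j : `|(Y - tetrahedron R) i j| <= 12 * mu.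
  have z12 : `|0 : R| <= 12 * mu by rewrite normr0 mulr_ge0.
  have le12 (u k : R) : `|u| <= k * mu -> k <= 12 -> `|u| <= 12 * mu.
    by move=> uk k12; apply: le_trans uk _; rewrite ler_wpM2r.
  have le1 (u : R) : `|u| <= mu -> `|u| <= 12 * mu.
    by move=> uk; apply: (le12 _ 1); [rewrite mul1r | lra].
  rewrite mxE [X in _ + X]mxE [X in _ - X]mxE.
  move: i j; apply: forall3; apply: forall4; rewrite /= ?oppr0 ?addr0 ?opprK.
  - by rewrite Y00 subrr.
  - by rewrite Y01 cE addrAC addNr add0r; apply: le1; exact: smu.
  - by rewrite Y02 addrAC addNr add0r; apply: le1; exact: smu.
  - by rewrite Y03 addrAC addNr add0r; apply: le1; exact: smu.
  - by rewrite Y10.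
  - by rewrite Y11; exact: le1.
  - by apply: (le12 _ 3) => //; lra.
  - by apply: (le12 _ 3) => //; lra.
  - by rewrite Y20.
  - by rewrite Y21.
  - by apply: (le12 _ 5) => //; lra.
  - by [].
exists (E^T *m tetrahedron R).
  apply/Omega_TP; rewrite trmx_mul trmxK mulmxA -(mulmxA _ E) EE mulmx1.
  exact: tetrahedron_gram.
have -> : G - E^T *m tetrahedron R = E^T *m (Y - tetrahedron R).
  by rewrite mulmxBr /Y mulmxA EtE mul1mx.
have E1 i j : `|E^T i j| <= 1.
  have := congr1 (fun M : 'M[R]_3 => M j j) EE; rewrite !mxE eqxx /= => e1.
  rewrite -(@ler_pXn2r _ 2)// ?nnegrE// expr1n -normrX ger0_norm ?sqr_ge0//.
  rewrite -[leRHS]e1 (bigD1 i)//= !mxE -expr2 lerDl.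
  by apply: sumr_ge0 => l _; rewrite !mxE -expr2 sqr_ge0.
apply: mx_norm_le; first by rewrite mulr_ge0.
move=> i j; rewrite mxE; apply: le_trans (ler_norm_sum _ _ _) _.
apply: le_trans (_ : \sum_(k < 3) (12 * mu) <= _); last first.
  by rewrite sumr_const card_ord -mulr_natl; lra.
apply: ler_sum => k _; rewrite normrM -[leRHS]mul1r.
by apply: ler_pM.
Qed.

(** * Invariance, exponential stability and the theorem *)

Lemma dist_set_le (R : realType) (V : normedModType R) (A : set V) x y :
  A y -> dist_set A x <= `|x - y|.
Proof.
move=> Ay; apply: ge_inf; last by exists y.
by exists 0 => _ [z _ <-].
Qed.

Lemma le_dist_set (R : realType) (V : normedModType R) (A : set V) x k :
  A !=set0 -> (forall y, A y -> k <= `|x - y|) -> k <= dist_set A x.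
Proof.
move=> [y Ay] h; apply: lb_le_inf; first by exists `|x - y|, y.
by move=> _ [z Az <-]; exact: h.
Qed.

Section Trajectories.
Context (R : realType) (f : R -> R).
Local Notation F := (closed_loop complete_graph f).
Local Notation V G := (energy (defect G)).

Lemma solution_energy_itv (I : set R) (gamma : R -> 'M[R]_(3, 4)) a b :
  is_interval I -> solution formations F I gamma -> I a -> I b ->
  {within `[a, b], continuous (fun t => V (gamma t))} /\
  forall t, t \in `]a, b[ ->
    formations (gamma t) /\
    is_derive t 1 (fun t => V (gamma t)) (energy_rate f (gamma t)).
Proof.
move=> Iitv [gX gc gd] Ia Ib.
have abI : `[a, b] `<=` I.
  by move=> t /=; rewrite in_itv /=; exact: (Iitv a b).
split.
  apply: (continuous_subspaceW abI) => t.
  exact: (continuous_comp (gc t) (continuous_energy R _)).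
move=> t tab; split.
  by apply/gX/abI; apply: subset_itv_oo_cc.
apply: is_derive_energy; apply: gd.
have : `]a, b[ `<=` I° .
  by rewrite -open_subsetE//; apply: subset_trans abI; exact: subset_itv_oo_cc.
by apply.
Qed.

Lemma energy_decay m C e I gamma a b : 0 < m ->
  (forall G, formations G -> V G < e ->
     - C * V G <= energy_rate f G <= - m * V G) ->
  is_interval I -> solution formations F I gamma -> I a -> I b -> a <= b ->
  V (gamma a) < e -> V (gamma b) <= V (gamma a) * expR (- m * (b - a)).
Proof.
move=> m0 bounds Iitv sol Ia Ib ab Va.
have [hc hd] := solution_energy_itv I gamma a b Iitv sol Ia Ib.
apply: (local_gronwall R (fun t => V (gamma t))
  (fun t => energy_rate f (gamma t)) a b (- m) e) => //.
- by move=> t /hd[].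
- by move=> t /hd[Ft _] /(bounds _ Ft)/andP[].
- move=> t; rewrite in_itv /= => /andP[at_ tb]; apply: le_lt_trans Va.
  rewrite -[leRHS]mulr1 ler_wpM2l ?energy_ge0// -expR0 ler_expR.
  by rewrite mulNr oppr_le0 mulr_ge0 ?subr_ge0// ltW.
Qed.

(** Reversing time turns the lower bound on the energy rate into a
    Gronwall inequality with constant [C]. *)
Lemma energy_zero_backward m C e I gamma a b : 0 < e ->
  (forall G, formations G -> V G < e ->
     - C * V G <= energy_rate f G <= - m * V G) ->
  is_interval I -> solution formations F I gamma -> I a -> I b -> a <= b ->
  V (gamma b) = 0 -> V (gamma a) <= 0.
Proof.
move=> e0 bounds Iitv sol Ia Ib ab Vb.
have [hc hd] := solution_energy_itv I gamma a b Iitv sol Ia Ib.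
have := local_gronwall R ((fun t => V (gamma t)) \o -%R)
  (fun t => - energy_rate f (gamma (- t))) (- b) (- a) C e.
rewrite /= !opprK Vb mul0r; apply.
- by rewrite lerN2.
- by apply: within_continuous_compN; rewrite !opprK.
- move=> t; rewrite -oppr_itvoo => tab; have [_ dt] := hd _ tab.
  by rewrite -mulrN1; apply: is_derive1_comp.
- move=> t; rewrite -oppr_itvoo => tab Vt; have [Ft _] := hd _ tab.
  by have /andP[h _] := bounds _ Ft Vt; rewrite lerNl -mulNr.
- by move=> t _; rewrite mul0r.
Qed.

End Trajectories.

(** The energy vanishes exactly on [Omega_T] and cannot leave zero, forward
    or backward in time.  The field is not assumed Lipschitz, so this replaces
    uniqueness of solutions. *)
Lemma invariant_Omega_T (R : realType) (f : R -> R) m C e : 0 < m -> 0 < e ->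
  (forall G, formations G -> energy (defect G) < e ->
     - C * energy (defect G) <= energy_rate f G <=
       - m * energy (defect G)) ->
  invariant_set formations (closed_loop complete_graph f) Omega_T.
Proof.
move=> m0 e0 bounds I gamma Iitv sol t0 It0 /energy_eq0 Wt0 t It.
have V0 : energy (defect (gamma t0)) = 0.
  by apply/eqP; rewrite eq_le Wt0 energy_ge0.
apply/energy_eq0; have [tt|/ltW tt] := leP t t0.
  exact: (energy_zero_backward R f m C e I gamma t t0).
have := energy_decay R f m C e I gamma t0 t m0 bounds Iitv sol It0 It tt.
by rewrite V0 mul0r => /(_ e0).
Qed.

(** The square root of the energy decays at the rate [m / 2], and [24] and
    [36] are the constants comparing it with the distance. *)
Lemma stable_Omega_T (R : realType) (f : R -> R) m C e : 0 < m -> 0 < e ->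
  (forall G, formations G -> energy (defect G) < e ->
     - C * energy (defect G) <= energy_rate f G <=
       - m * energy (defect G)) ->
  locally_exponentially_stable formations (closed_loop complete_graph f) Omega_T.
Proof.
move=> m0 e0 bounds.
pose d := Num.min (Num.sqrt e) (1 / 100).
have d0 : 0 < d by rewrite lt_min sqrtr_gt0 e0 /=; lra.
have [de d1] : d <= Num.sqrt e /\ d <= 1 / 100 by rewrite !ge_min !lexx orbT.
(* Starting at distance less than [d / 24] keeps the energy below [e] and the
   defect in the range of [close_tetrahedron]. *)
exists (d / 24), (36 * 24), (m / 2); split; [lra | lra | lra |].
move=> I gamma Iitv I0 sol dist0 t It t0.
have [gX _ _] := sol.
have start : Num.sqrt (energy (defect (gamma 0))) <=
    24 * dist_set Omega_T (gamma 0).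
  rewrite mulrC -ler_pdivrMr//; apply: le_dist_set.
    by exists (tetrahedron R); exact: tetrahedron_Omega_T.
  move=> P OP; rewrite ler_pdivrMr// mulrC.
  by apply: sqrt_energy_le_dist => //; exact: gX.
have start_d : Num.sqrt (energy (defect (gamma 0))) < d by lra.
have Ve : energy (defect (gamma 0)) < e.
  by rewrite -ltr_sqrt//; apply: lt_le_trans de.
have := energy_decay R f m C e I gamma 0 t m0 bounds Iitv sol I0 It t0 Ve.
rewrite subr0 => decay.
have sqrt_decay : Num.sqrt (energy (defect (gamma t))) <=
    Num.sqrt (energy (defect (gamma 0))) * expR (- (m / 2 * t)).
  apply: le_trans (ler_wsqrtr decay) _.
  rewrite sqrtrM ?energy_ge0//.
  have -> : expR (- m * t) = expR (- (m / 2 * t)) ^+ 2.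
    by rewrite -expRM_natl; congr expR; rewrite -mulr_natl; field.
  by rewrite sqrtr_sqr ger0_norm// expR_ge0.
have small : Num.sqrt (energy (defect (gamma t))) <= 1 / 100.
  apply: le_trans sqrt_decay _; apply: le_trans (_ : d * 1 <= _); last by rewrite mulr1.
  rewrite ler_pM ?sqrtr_ge0 ?expR_ge0//; first exact: ltW.
  by rewrite -expR0 ler_expR oppr_le0 mulr_ge0// divr_ge0// ltW.
have [P OP close] := close_tetrahedron R (gamma t) (gX _ It) small.
apply: le_trans (dist_set_le _ _ _ _ _ OP) _; apply: le_trans close _.
rewrite -2!(mulrA 36) ler_wpM2l//; apply: le_trans sqrt_decay _.
by rewrite [leRHS]mulrAC ler_wpM2r ?expR_ge0.
Qed.

Theorem theorem4p8 (R : realType) (f : R -> R)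
    (f_bounded : bounded_fun f)
    (f_gt0 : forall x : R, 0 < x < pi -> 0 < f x)
    (f_derivable : forall x : R, 0 < x < pi -> derivable f x 1)
    (df_lt0 : forall x : R, 0 < x < pi -> (f^`())%classic x < 0) :
  (forall G, Omega_T G ->
     center_manifold formations (closed_loop complete_graph f) Omega_T G) /\
  locally_exponentially_stable formations (closed_loop complete_graph f) Omega_T.
Proof.
have a0 := f_gt0 _ (acos_third_itv R).
have [b b0 db] := coupling_derive R f f_derivable df_lt0.
have [m [C [e [m0 _ e0 bounds]]]] := energy_rate_bounds R f b a0 b0 db.
split; last exact: (stable_Omega_T R f m C e).
move=> G OG; have /Omega_TP GG := OG; split.
- split; first exact: closed_loop_tetra.
  exact: (differentiable_closed_loop _ _ _ db _ GG).
- by split=> //; exact: Omega_T_formations.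
- exact: submanifold_Omega_T.
- exact: (invariant_Omega_T R f m C e).
- exact: (tangent_center R f b).
Qed.
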